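(* (1) $E_0$ is not infinite time computably reducible to the equality relation $=$ on $\mathbb{R}$. (2) $E_{\mathrm{set}}$ is not infinite time computably reducible to $E_0$. (3) Neither $\cong_{\mathrm{HC}}$ nor $E_{\mathrm{set}}$ is infinite time computably reducible to $\cong_{\mathrm{WO}}$.
   Context: $\mathbb{R}=2^\omega$. Infinite time Turing machines: Turing machines with three binary $\omega$-tapes run in transfinite ordinal time, with a special limit state at limit stages, head reset to the first cell, cells taking the $\limsup$ of earlier values. A function is infinite time computable if computed by such a machine, possibly with a fixed real parameter. For equivalence relations $E$ on $X\subseteq\mathbb{R}$, $F$ on $Y\subseteq\mathbb{R}$, $E\le_c F$ means there is an infinite time computable $f:X\to Y$ with $x\,E\,x'\iff f(x)\,F\,f(x')$. $x\,E_0\,y$ iff $x(n)=y(n)$ for all but finitely many $n$. A real $x$ codes a countable sequence of reals $(x)_n$ (via a fixed recursive pairing), and $x\,E_{\mathrm{set}}\,y$ iff $\{(x)_n:n\in\omega\}=\{(y)_n:n\in\omega\}$. A real codes a binary relation on $\omega$ via bit $\langle n,m\rangle$; $\mathrm{WO}$ is the set of codes of well-orders and $\cong_{\mathrm{WO}}$ is isomorphism on $\mathrm{WO}$; $\cong_{\mathrm{HC}}$ is isomorphism restricted to the set of reals coding hereditarily countable sets (codes of well-founded extensional relations on $\omega$, representing the transitive closure of a set). *)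

(* Defs.v *)
From Stdlib Require Import Arith PeanoNat Wellfounded.

Definition Real := nat -> bool.

Definition real_eq (x y : Real) : Prop := forall n, x n = y n.

Definition pair (n m : nat) : nat := (n + m) * (n + m + 1) / 2 + m.

(** States are natural numbers; 0 = start, 1 = halt, 2 = limit state.
    A program has finitely many states (those < nstates), and a transition
    function which, given the current state and the three bits under the
    (single, shared) head on the input, scratch and output tapes, returns
    the new state, the three bits to write, and a move (true = right,
    false = left; moving left at cell 0 leaves the head at 0). *)
Record Program := {
  nstates : nat;
  delta : nat -> bool -> bool -> bool -> nat * bool * bool * bool * bool
}.

Definition valid_program (P : Program) : Prop :=
  3 <= nstates P /\
  forall s b1 b2 b3, s < nstates P ->
    let '(s', _, _, _, _) := delta P s b1 b2 b3 in s' < nstates P.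

Record Config := {
  st : nat;
  hd : nat;
  tape1 : nat -> bool;   (* input tape *)
  tape2 : nat -> bool;   (* scratch tape *)
  tape3 : nat -> bool    (* output tape *)
}.

Definition upd (t : nat -> bool) (h : nat) (b : bool) : nat -> bool :=
  fun n => if Nat.eqb n h then b else t n.

Definition step (P : Program) (c : Config) : Config :=
  let '(s', w1, w2, w3, mvR) :=
      delta P (st c) (tape1 c (hd c)) (tape2 c (hd c)) (tape3 c (hd c)) in
  {| st := s';
     hd := if mvR then S (hd c) else Nat.pred (hd c);
     tape1 := upd (tape1 c) (hd c) w1;
     tape2 := upd (tape2 c) (hd c) w2;
     tape3 := upd (tape3 c) (hd c) w3 |}.

Definition init_config (inp : Real) : Config :=
  {| st := 0; hd := 0; tape1 := inp;
     tape2 := fun _ => false; tape3 := fun _ => false |}.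

(** Strict well-orders, used as (the successor ordinal of) running times. *)
Definition strict_well_order {T : Type} (lt : T -> T -> Prop) : Prop :=
  (forall a, ~ lt a a) /\
  (forall a b c, lt a b -> lt b c -> lt a c) /\
  (forall a b, lt a b \/ a = b \/ lt b a) /\
  well_founded lt.

Definition is_pred {T : Type} (lt : T -> T -> Prop) (s t : T) : Prop :=
  lt s t /\ forall u, ~ (lt s u /\ lt u t).

Definition is_zero {T : Type} (lt : T -> T -> Prop) (t : T) : Prop :=
  forall u, ~ lt u t.

Definition limsup_true {T : Type} (lt : T -> T -> Prop) (f : T -> bool) (t : T)
  : Prop :=
  forall s, lt s t -> exists u, (s = u \/ lt s u) /\ lt u t /\ f u = true.

Definition limit_rule {T : Type} (lt : T -> T -> Prop) (c : T -> Config) (t : T)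
  : Prop :=
  st (c t) = 2 /\ hd (c t) = 0 /\
  (forall n, tape1 (c t) n = true <-> limsup_true lt (fun u => tape1 (c u) n) t) /\
  (forall n, tape2 (c t) n = true <-> limsup_true lt (fun u => tape2 (c u) n) t) /\
  (forall n, tape3 (c t) n = true <-> limsup_true lt (fun u => tape3 (c u) n) t).

Definition halts_with (P : Program) (inp out : Real) : Prop :=
  exists (T : Type) (lt : T -> T -> Prop) (c : T -> Config) (top : T),
    strict_well_order lt /\
    (forall t, t = top \/ lt t top) /\
    (forall t, is_zero lt t -> c t = init_config inp) /\
    (forall s t, is_pred lt s t -> c t = step P (c s)) /\
    (forall t, ~ is_zero lt t -> (forall s, ~ is_pred lt s t) -> limit_rule lt c t) /\
    (forall t, t <> top -> st (c t) <> 1) /\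
    st (c top) = 1 /\
    (forall n, tape3 (c top) n = out n).

(** Join of two reals, used to supply a real parameter on the input tape. *)
Definition join (x z : Real) : Real :=
  fun n => if Nat.even n then x (Nat.div2 n) else z (Nat.div2 n).

Definition itt_computable_on (X : Real -> Prop) (f : Real -> Real) : Prop :=
  exists (P : Program) (z : Real),
    valid_program P /\ forall x, X x -> halts_with P (join x z) (f x).

Definition itt_reducible (X : Real -> Prop) (E : Real -> Real -> Prop)
                         (Y : Real -> Prop) (F : Real -> Real -> Prop) : Prop :=
  exists f : Real -> Real,
    itt_computable_on X f /\
    (forall x, X x -> Y (f x)) /\
    (forall x x', X x -> X x' -> (E x x' <-> F (f x) (f x'))).

Definition allR : Real -> Prop := fun _ => True.

Definition E0 (x y : Real) : Prop :=
  exists N, forall n, N <= n -> x n = y n.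

Definition seq_elem (x : Real) (n : nat) : Real := fun k => x (pair n k).

Definition Eset (x y : Real) : Prop :=
  (forall n, exists m, real_eq (seq_elem x n) (seq_elem y m)) /\
  (forall m, exists n, real_eq (seq_elem y m) (seq_elem x n)).

Definition rel (x : Real) (n m : nat) : Prop := x (pair n m) = true.

(** Well-orders are coded as reflexive linear orders on their field
    {n | rel x n n}. *)
Definition field (x : Real) (n : nat) : Prop := rel x n n.

Definition WO (x : Real) : Prop :=
  (forall n m, rel x n m -> field x n /\ field x m) /\
  (forall n m, rel x n m -> rel x m n -> n = m) /\
  (forall n m k, rel x n m -> rel x m k -> rel x n k) /\
  (forall n m, field x n -> field x m -> rel x n m \/ rel x m n) /\
  (forall A : nat -> Prop, (exists n, A n /\ field x n) ->
     exists n, A n /\ field x n /\ forall m, A m -> field x m -> rel x n m).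

Definition iso_WO (x y : Real) : Prop :=
  exists f : nat -> nat,
    (forall n, field x n -> field y (f n)) /\
    (forall n m, field x n -> field x m -> f n = f m -> n = m) /\
    (forall k, field y k -> exists n, field x n /\ f n = k) /\
    (forall n m, field x n -> field x m -> (rel x n m <-> rel y (f n) (f m))).

(** Codes of hereditarily countable sets: well-founded extensional
    relations on omega. *)
Definition HC (x : Real) : Prop :=
  well_founded (rel x) /\
  (forall a b, (forall c, rel x c a <-> rel x c b) -> a = b).

Definition iso_HC (x y : Real) : Prop :=
  exists f : nat -> nat,
    (forall n m, f n = f m -> n = m) /\
    (forall k, exists n, f n = k) /\
    (forall n m, rel x n m <-> rel y (f n) (f m)).

(* Main.v *)
From Stdlib Require Import Arith PeanoNat Lia List Bool Wellfounded Cantor PArith.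
From Stdlib Require Import Classical ClassicalEpsilon FunctionalExtensionality.
From Stdlib Require Import PropExtensionality ProofIrrelevance.
Require Import Defs.
Import ListNotations.

(** The outputs of an infinite time machine depend on its input in a Baire-measurable way.
    Consider the runs on all inputs at once, up to meager sets of inputs. By the countable
    chain condition, the values forced to recur stabilize at a countable stage, so for
    suitable countable limits [d < d'] comeagerly many runs have the same configuration at
    [d] and at [d'] and keep every 0 of stage [d] in between. Such a run loops forever; as
    the machine halts on all inputs, comeagerly many runs halt by stage [d'], up to which
    everything has the Baire property.

    It remains to refute Baire-measurable reductions.
    - From [E0] to equality: two conditions of the same length have [E0]-equivalent generic
      extensions, so all generic reals have the same image.
    - From [E0] to isomorphism of well-orders: the order types of the images are bounded on a
      comeager set, so one of them occurs on a nonmeager set. [E0] reduces continuously to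
      both [Eset] and isomorphism of hereditarily countable sets.
    - From [E3], the countable power of [E0], to [E0]: either one can build row-wise
      [E0]-equivalent generics whose images differ infinitely often, or below some condition
      the image depends, up to [E0], only on finitely many rows. [E3] reduces continuously
      to [Eset]. *)

(** * Choice and countable index types *)

Lemma fun_choice (A B : Type) (R : A -> B -> Prop) :
  (forall a, exists b, R a b) -> exists f, forall a, R a (f a).
Proof.
  intros H.
  exists (fun a => proj1_sig (constructive_indefinite_description _ (H a))).
  intros a. apply proj2_sig.
Qed.

Definition countable (I : Type) : Prop := exists e : nat -> I, forall i, exists n, e n = i.

Lemma countable_prod (I J : Type) : countable I -> countable J -> countable (I * J).
Proof.
  intros [e He] [g Hg].
  exists (fun n => (e (fst (of_nat n)), g (snd (of_nat n)))).
  intros [i j]. destruct (He i) as [a <-], (Hg j) as [b <-].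
  exists (to_nat (a, b)). now rewrite cancel_of_to.
Qed.

Lemma countable_nat : countable nat.
Proof. exists (fun n => n). eauto. Qed.

Lemma countable_bool : countable bool.
Proof. exists (Nat.eqb 0). intros [|]; [exists 0 | exists 1]; reflexivity. Qed.

Lemma countable_list_bool : countable (list bool).
Proof.
  (* The digits of a positive number below its leading 1, read from the least significant one, run
     through all bit lists. *)
  set (dec := fix dec (p : positive) : list bool :=
    match p with xH => [] | xO p => false :: dec p | xI p => true :: dec p end).
  exists (fun n => dec (Pos.of_nat n)).
  intros s.
  assert (H : exists p, dec p = s).
  { induction s as [|b s [p <-]]; [now exists xH|].
    destruct b; [now exists (xI p) | now exists (xO p)]. }
  destruct H as [p <-]. exists (Pos.to_nat p). now rewrite Pos2Nat.id.
Qed.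

(** * Baire category in Cantor space *)

Definition ext {X : Type} (s t : list X) : Prop := exists u, t = s ++ u.

Definition pre (s : list bool) (x : Real) : Prop :=
  forall i, i < length s -> nth i s false = x i.

Definition prefix (x : Real) (n : nat) : list bool := map x (seq 0 n).

Lemma ext_refl {X : Type} (s : list X) : ext s s.
Proof. exists []. now rewrite app_nil_r. Qed.

Lemma ext_trans {X : Type} (s t u : list X) : ext s t -> ext t u -> ext s u.
Proof. intros [a ->] [b ->]. exists (a ++ b). now rewrite app_assoc. Qed.

Lemma ext_nil {X : Type} (s : list X) : ext [] s.
Proof. now exists s. Qed.

Lemma ext_length {X : Type} (s t : list X) : ext s t -> length s <= length t.
Proof. intros [u ->]. rewrite length_app. lia. Qed.

Lemma ext_nth {X : Type} (d : X) s t i : ext s t -> i < length s -> nth i t d = nth i s d.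
Proof. intros [u ->] Hi. now apply app_nth1. Qed.

Lemma ext_of_nth {X : Type} (d : X) s t : length s <= length t ->
  (forall i, i < length s -> nth i s d = nth i t d) -> ext s t.
Proof.
  intros Hl Hn. exists (skipn (length s) t).
  rewrite <- (firstn_skipn (length s) t) at 1. f_equal.
  apply nth_ext with (d := d) (d' := d).
  - rewrite length_firstn. lia.
  - intros i Hi. rewrite length_firstn in Hi. rewrite nth_firstn.
    replace (i <? length s) with true by (symmetry; apply Nat.ltb_lt; lia).
    symmetry. apply Hn. lia.
Qed.

Lemma pre_nil x : pre [] x.
Proof. intros i Hi. simpl in Hi. lia. Qed.

Lemma pre_ext s t x : ext s t -> pre t x -> pre s x.
Proof.
  intros H Ht i Hi. rewrite <- (ext_nth false s t i H Hi). apply Ht.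
  apply ext_length in H. lia.
Qed.

Lemma pre_cmp s t x : pre s x -> pre t x -> length s <= length t -> ext s t.
Proof.
  intros Hs Ht Hl. apply (ext_of_nth false); auto.
  intros i Hi. rewrite Hs, Ht; auto; lia.
Qed.

Lemma prefix_length x n : length (prefix x n) = n.
Proof. unfold prefix. now rewrite length_map, length_seq. Qed.

Lemma prefix_nth x n i : i < n -> nth i (prefix x n) false = x i.
Proof.
  intros Hi. unfold prefix.
  rewrite nth_indep with (d' := x 0) by now rewrite length_map, length_seq.
  rewrite map_nth. now rewrite seq_nth.
Qed.

Lemma prefix_pre x n : pre (prefix x n) x.
Proof. intros i Hi. rewrite prefix_length in Hi. now apply prefix_nth. Qed.

Lemma ext_longer (s : list bool) n : exists t, ext s t /\ n <= length t.
Proof.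
  exists (s ++ repeat false n). split; [now eexists|].
  rewrite length_app, repeat_length. lia.
Qed.

(** Rasiowa-Sikorski: the requirements are met one per stage, [D n] at stage [n]. An arbitrary
    preorder is allowed because the lemma serves single reals as well as pairs. *)
Lemma generic_sequence (C : Type) (le : C -> C -> Prop) (D : nat -> C -> Prop) (p : C) :
  (forall c, le c c) -> (forall a b c, le a b -> le b c -> le a c) ->
  (forall j c, le p c -> exists d, le c d /\ D j d) ->
  exists q : nat -> C, le p (q 0) /\ (forall n, le (q n) (q (S n))) /\ (forall n, D n (q n)).
Proof.
  intros Hr Ht Hd.
  destruct (fun_choice (nat * C) C
    (fun jc d => le p (snd jc) -> le (snd jc) d /\ D (fst jc) d)) as [f Hf].
  { intros [j c]. destruct (classic (le p c)) as [H|H].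
    - destruct (Hd j c H) as [d Hd']. now exists d.
    - now exists c. }
  set (q := fix q n := match n with 0 => f (0, p) | S n => f (S n, q n) end).
  assert (Hp : forall n, le p (q n) /\ D n (q n)).
  { induction n as [|n [IH _]].
    - exact (Hf (0, p) (Hr p)).
    - destruct (Hf (S n, q n) IH) as [H1 H2]. split; [|exact H2].
      exact (Ht _ _ _ IH H1). }
  exists q. repeat split; intros; try apply Hp.
  destruct (Hf (S n, q n) (proj1 (Hp n))) as [H1 _]. exact H1.
Qed.

Lemma chain_le (C : Type) (le : C -> C -> Prop) (q : nat -> C) :
  (forall c, le c c) -> (forall a b c, le a b -> le b c -> le a c) ->
  (forall n, le (q n) (q (S n))) -> forall n m, n <= m -> le (q n) (q m).
Proof. intros Hr Ht Hq n m H. induction H; eauto. Qed.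

Lemma chain_limit (q : nat -> list bool) :
  (forall n, ext (q n) (q (S n))) -> (forall n, n <= length (q n)) ->
  exists x, forall n, pre (q n) x.
Proof.
  (* Bit [i] is read from [q (S i)], which is long enough for the default value never to be used. *)
  intros Hq Hl. exists (fun i => nth i (q (S i)) false).
  intros n i Hi. pose proof (chain_le (list bool) ext q ext_refl ext_trans Hq) as Hc.
  specialize (Hl (S i)).
  destruct (Nat.le_gt_cases n (S i)) as [H|H].
  - symmetry. apply ext_nth; auto.
  - apply ext_nth; [|lia]. apply Hc. lia.
Qed.

(* [forces s A]: the set [A] is comeager in the basic open set of [s]. *)
Definition forces (s : list bool) (A : Real -> Prop) : Prop :=
  exists D : nat -> list bool -> Prop,
    (forall j t, ext s t -> exists u, ext t u /\ D j u) /\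
    (forall x, pre s x -> (forall j, exists u, pre u x /\ D j u) -> A x).

(** The dense sets belonging to all [i] are merged into one sequence by pairing. *)
Lemma forces_all (s : list bool) (I : Type) (A : I -> Real -> Prop) :
  countable I -> (forall i, forces s (A i)) -> forces s (fun x => forall i, A i x).
Proof.
  intros [e He] H. destruct (fun_choice _ _ _ H) as [D HD].
  exists (fun n => D (e (fst (of_nat n))) (snd (of_nat n))). split.
  - intros j t Ht. now apply HD.
  - intros x Hx Hm i. destruct (He i) as [n <-]. apply (proj2 (HD (e n)) x Hx).
    intros j. destruct (Hm (to_nat (n, j))) as [u Hu].
    rewrite cancel_of_to in Hu. now exists u.
Qed.

Lemma forces_mono s (A B : Real -> Prop) :
  forces s A -> (forall x, pre s x -> A x -> B x) -> forces s B.
Proof. intros [D [H1 H2]] H. exists D. split; auto. Qed.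

Lemma forces_ext s t A : forces s A -> ext s t -> forces t A.
Proof.
  intros [D [H1 H2]] H. exists D. split.
  - intros j u Hu. apply H1. eapply ext_trans; eauto.
  - intros x Hx. apply H2. eapply pre_ext; eauto.
Qed.

Lemma forces_true s (A : Real -> Prop) : (forall x, pre s x -> A x) -> forces s A.
Proof.
  intros H. exists (fun _ _ => True). split; auto.
  intros _ t _. exists t. split; auto using ext_refl.
Qed.

Lemma forces_and s A B : forces s A -> forces s B -> forces s (fun x => A x /\ B x).
Proof.
  intros HA HB.
  apply forces_mono with (A := fun x => forall b : bool, (if b then A else B) x).
  - apply forces_all; [apply countable_bool|]. intros [|]; auto.
  - intros x _ H. exact (conj (H true) (H false)).
Qed.

(** Baire category theorem for Cantor space. *)
Lemma forces_inhabited s A : forces s A -> exists x, pre s x /\ A x.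
Proof.
  intros [D [H1 H2]].
  (* Asking also for length at least [j] at stage [j] makes the chain converge to a real. *)
  destruct (generic_sequence _ ext (fun j t => (exists u, ext u t /\ D j u) /\ j <= length t) s)
    as [q [Hs [Hq HD]]]; eauto using ext_refl, ext_trans.
  - intros j t Ht. destruct (H1 j t Ht) as [u [Hu Du]].
    destruct (ext_longer u j) as [v [Hv Hl]].
    exists v. split; [eapply ext_trans; eauto|]. eauto.
  - destruct (chain_limit q Hq (fun n => proj2 (HD n))) as [x Hx].
    exists x. assert (Hsx : pre s x) by (eapply pre_ext; eauto).
    split; auto. apply H2; auto. intros j.
    destruct (HD j) as [[u [Hu Du]] _]. exists u. split; auto. eapply pre_ext; eauto.
Qed.

Lemma forces_not_both s A : forces s A -> forces s (fun x => ~ A x) -> False.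
Proof.
  intros H1 H2. destruct (forces_inhabited s _ (forces_and _ _ _ H1 H2)) as [x [_ [H H']]].
  auto.
Qed.

(** Each dense set is enlarged by the conditions incompatible with [t]; a real extending [t] can
    only meet it below [t]. *)
Lemma forces_below s t A :
  forces t A -> forces s (fun x => pre t x -> A x).
Proof.
  intros [D [H1 H2]].
  exists (fun j u => (forall x, ~ (pre u x /\ pre t x)) \/ (ext t u /\ D j u)). split.
  - intros j u _.
    destruct (classic (exists x, pre u x /\ pre t x)) as [[x [Hu Ht]]|H].
    + set (v := prefix x (length u + length t)).
      assert (Hv : pre v x) by apply prefix_pre.
      assert (Huv : ext u v).
      { eapply pre_cmp; eauto. unfold v. rewrite prefix_length. lia. }
      assert (Htv : ext t v).
      { eapply pre_cmp; eauto. unfold v. rewrite prefix_length. lia. }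
      destruct (H1 j v Htv) as [w [Hw Dw]].
      exists w. split; [eapply ext_trans; eauto|]. right. split; auto. eapply ext_trans; eauto.
    + exists u. split; [apply ext_refl|]. left. intros x Hx. apply H. now exists x.
  - intros x _ Hm Ht. apply H2; auto. intros j.
    destruct (Hm j) as [u [Hu [H|[Htu Du]]]]; [now destruct (H x)|]. now exists u.
Qed.

(** There are only countably many conditions, so comeagerly many reals are good for all conditions
    forcing [A] at once, and comeagerly many pass through one of them. *)
Lemma forces_dense s A :
  (forall t, ext s t -> exists u, ext t u /\ forces u A) -> forces s A.
Proof.
  intros H.
  assert (HH : forces s (fun x => forall t, forces t A -> pre t x -> A x)).
  { apply forces_all; [apply countable_list_bool|]. intros t.
    destruct (classic (forces t A)) as [Ht|Ht].
    - eapply forces_mono; [apply forces_below; eauto|]. eauto.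
    - apply forces_true. tauto. }
  assert (HM : forces s (fun x => exists t, forces t A /\ pre t x)).
  { exists (fun _ t => forces t A). split; [auto|].
    intros x Hx Hm. destruct (Hm 0) as [u [Hu HA]]. eauto. }
  eapply forces_mono; [exact (forces_and _ _ _ HH HM)|].
  intros x _ [H1 [t [Ht Hp]]]. eauto.
Qed.

(* The Baire property: densely many basic open sets decide [A] up to a meager set. *)
Definition BP (A : Real -> Prop) : Prop :=
  forall s, exists t, ext s t /\ (forces t A \/ forces t (fun x => ~ A x)).

Lemma BP_iff A B : (forall x, A x <-> B x) -> BP A -> BP B.
Proof.
  intros H HA s. destruct (HA s) as [t [Ht [H1|H1]]]; exists t; split; auto.
  - left. eapply forces_mono; eauto. intros x _. apply H.
  - right. eapply forces_mono; eauto. intros x _ Hn Hb. apply Hn, H, Hb.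
Qed.

Lemma BP_not A : BP A -> BP (fun x => ~ A x).
Proof.
  intros HA s. destruct (HA s) as [t [Ht [H1|H1]]]; exists t; split; auto.
  right. eapply forces_mono; eauto.
Qed.

(** The Baire property turns not being forced anywhere below [s] into being meager below [s]; the
    boundedness arguments later use it in this form. *)
Lemma BP_no_extension s A : BP A ->
  (forall t, ext s t -> ~ forces t A) -> forces s (fun x => ~ A x).
Proof.
  intros HA H. apply forces_dense. intros t Ht.
  destruct (HA t) as [u [Hu [H1|H1]]]; [|eauto].
  destruct (H u); auto. eapply ext_trans; eauto.
Qed.

(** Below [s], either some condition forces a single [A i], or every [A i] is meager and so is their
    countable union. *)
Lemma BP_ex (I : Type) (A : I -> Real -> Prop) :
  countable I -> (forall i, BP (A i)) -> BP (fun x => exists i, A i x).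
Proof.
  intros HI HA s.
  destruct (classic (exists t i, ext s t /\ forces t (A i))) as [[t [i [Ht H]]]|H].
  - exists t. split; auto. left. eapply forces_mono; eauto.
  - exists s. split; [apply ext_refl|]. right.
    apply forces_mono with (A := fun x => forall i, ~ A i x).
    + apply forces_all; auto. intros i. apply BP_no_extension; auto.
      intros t Ht Hf. apply H. eauto.
    + intros x _ Hx [i Hi]. eapply Hx; eauto.
Qed.

Lemma BP_all (I : Type) (A : I -> Real -> Prop) :
  countable I -> (forall i, BP (A i)) -> BP (fun x => forall i, A i x).
Proof.
  intros HI HA. apply BP_iff with (A := fun x => ~ exists i, ~ A i x).
  - intros x. split; [|firstorder]. intros H i. apply NNPP. intros Hi. eauto.
  - apply BP_not, BP_ex; auto. intros i. apply BP_not; auto.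
Qed.

Lemma BP_const (Q : Prop) : BP (fun _ => Q).
Proof.
  intros s. exists s. split; [apply ext_refl|].
  destruct (classic Q); [left|right]; apply forces_true; auto.
Qed.

Lemma BP_and A B : BP A -> BP B -> BP (fun x => A x /\ B x).
Proof.
  intros HA HB.
  apply BP_iff with (A := fun x => forall b : bool, (if b then A else B) x).
  - intros x. split; [intros H; exact (conj (H true) (H false))|].
    intros [H1 H2] [|]; auto.
  - apply BP_all; [apply countable_bool|]. intros [|]; auto.
Qed.

Lemma BP_imp A B : BP A -> BP B -> BP (fun x => A x -> B x).
Proof.
  intros HA HB. apply BP_iff with (A := fun x => ~ (A x /\ ~ B x)).
  - intros x. split; [|tauto]. intros H HA'. apply NNPP. tauto.
  - apply BP_not, BP_and; auto. now apply BP_not.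
Qed.

Lemma BP_bit n : BP (fun x => x n = true).
Proof.
  intros s. destruct (ext_longer s (S n)) as [t [Ht Hl]]. exists t. split; auto.
  destruct (nth n t false) eqn:E; [left|right]; apply forces_true;
    intros x Hx; rewrite (Hx n) in E by lia; congruence.
Qed.

Lemma BP_almost A B : forces [] (fun x => A x <-> B x) -> BP A -> BP B.
Proof.
  intros H HA s. destruct (HA s) as [t [Ht Hd]]. exists t. split; auto.
  assert (H' := forces_ext _ t _ H (ext_nil t)).
  destruct Hd as [Hd|Hd]; [left|right];
    (eapply forces_mono; [exact (forces_and _ _ _ Hd H')|]); cbn; tauto.
Qed.

(** * The first uncountable ordinal *)

(* [Sup f] stands for the least ordinal above all [f n]. *)
Inductive Tree : Type := Zero | Sup (f : nat -> Tree).

(** Comparison of heights, where the height of [Sup f] is the supremum of the successors of the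
    heights of the [f n]. *)
Fixpoint tle (a : Tree) : Tree -> Prop :=
  match a with
  | Zero => fun _ => True
  | Sup f => fun b => forall n, match b with Zero => False | Sup g => exists m, tle (f n) (g m) end
  end.

Definition tlt (a b : Tree) : Prop :=
  match b with Zero => False | Sup g => exists m, tle a (g m) end.

Lemma tle_refl a : tle a a.
Proof. induction a as [|f IH]; simpl; eauto. Qed.

Lemma tle_trans a b c : tle a b -> tle b c -> tle a c.
Proof.
  revert b c. induction a as [|f IH]; simpl; auto.
  intros [|g] c H1 H2 n; [destruct (H1 n)|].
  destruct (H1 n) as [m Hm]. specialize (H2 m). destruct c as [|h]; auto.
  destruct H2 as [k Hk]. eauto.
Qed.

Lemma tlt_le_trans a b c : tlt a b -> tle b c -> tlt a c.
Proof.
  destruct b as [|g]; simpl; [tauto|]. intros [m Hm] H. specialize (H m).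
  destruct c as [|h]; simpl; auto. destruct H as [k Hk]. eauto using tle_trans.
Qed.

Lemma tlt_le a b : tlt a b -> tle a b.
Proof.
  revert b. induction a as [|f IH]; simpl; auto.
  intros [|g]; simpl; [tauto|]. intros [m Hm] n. exists m. apply IH.
  apply tlt_le_trans with (b := Sup f); [|exact Hm]. simpl. exists n. apply tle_refl.
Qed.

Lemma tle_or_gt a b : tle a b \/ tlt b a.
Proof.
  revert b. induction a as [|f IH]; intros b; [now left|].
  destruct (classic (forall n, tlt (f n) b)) as [H|H]; [now left|].
  right. apply not_all_ex_not in H. destruct H as [n Hn]. exists n.
  destruct b as [|g]; simpl; auto. intros m.
  destruct (IH n (g m)) as [H|H]; auto. destruct Hn. now exists m.
Qed.

Lemma tlt_wf : well_founded tlt.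
Proof.
  assert (H : forall a b, tle b a -> Acc tlt b).
  { induction a as [|f IH]; intros b Hb; constructor; intros y Hy;
      apply (tlt_le_trans y b) in Hb; auto; simpl in Hb; [tauto|].
    destruct Hb as [m Hm]. eauto. }
  intros a. apply (H a), tle_refl.
Qed.

Lemma tlt_irrefl a : ~ tlt a a.
Proof. induction (tlt_wf a) as [a _ IH]. intros H. exact (IH a H H). Qed.

Definition canon (a : Tree) : Tree :=
  epsilon (inhabits Zero) (fun b => tle a b /\ tle b a).

Lemma canon_spec a : tle a (canon a) /\ tle (canon a) a.
Proof.
  unfold canon. apply epsilon_spec. exists a. split; apply tle_refl.
Qed.

(** [epsilon] depends only on its predicate, and extensionality identifies the predicates of trees
    of equal height. *)
Lemma canon_eq a b : tle a b -> tle b a -> canon a = canon b.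
Proof.
  intros H1 H2. unfold canon. f_equal. apply functional_extensionality. intros c.
  apply propositional_extensionality. split; intros [H3 H4]; split; eauto using tle_trans.
Qed.

(** The fixed points of [canon] stand for the quotient by equal height, that is, for the countable
    ordinals. *)
Definition Omega1 : Type := {a : Tree | canon a = a}.

Definition olt (a b : Omega1) : Prop := tlt (proj1_sig a) (proj1_sig b).

Lemma canon_idem a : canon (canon a) = canon a.
Proof. apply canon_eq; apply canon_spec. Qed.

Definition to_omega1 (a : Tree) : Omega1 := exist _ (canon a) (canon_idem a).

Lemma olt_swo : strict_well_order olt.
Proof.
  split; [|split; [|split]].
  - intros a. apply tlt_irrefl.
  - intros a b c H1 H2. eapply tlt_le_trans; eauto. now apply tlt_le.
  - intros [a Ha] [b Hb]. unfold olt; simpl.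
    destruct (tle_or_gt a b) as [H1|H1]; auto.
    destruct (tle_or_gt b a) as [H2|H2]; auto. right; left.
    assert (E : a = b) by (rewrite <- Ha, <- Hb; now apply canon_eq).
    subst b. f_equal. apply proof_irrelevance.
  - exact (wf_inverse_image _ _ tlt (@proj1_sig _ _) tlt_wf).
Qed.

(** Regularity: the [Sup] of an enumeration bounds a countable family. *)
Lemma omega1_sup (I : Type) (f : I -> Omega1) :
  countable I -> exists b, forall i, olt (f i) b.
Proof.
  intros [e He]. exists (to_omega1 (Sup (fun n => proj1_sig (f (e n))))).
  intros i. destruct (He i) as [n <-]. unfold olt, to_omega1. cbn [proj1_sig].
  refine (tlt_le_trans _ _ _ _ (proj1 (canon_spec _))). exists n. apply tle_refl.
Qed.

Lemma omega1_segment (b : Omega1) :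
  exists e : nat -> Omega1, forall a, olt a b -> exists n, e n = a.
Proof.
  assert (H : forall t, exists e : nat -> Tree,
    forall a, tlt a t -> exists n, tle (e n) a /\ tle a (e n)).
  { induction t as [|f IH].
    - exists (fun _ => Zero). intros a [].
    - destruct (fun_choice _ _ _ IH) as [e He].
      (* Index [(m, 0)] gives [f m] itself, and [(m, S k)] the ordinals below it. *)
      exists (fun n => match snd (of_nat n) with
                       | 0 => f (fst (of_nat n)) | S k => e (fst (of_nat n)) k end).
      intros a [m Hm]. destruct (tle_or_gt (f m) a) as [H|H].
      + exists (to_nat (m, 0)). rewrite cancel_of_to. auto.
      + destruct (He m a H) as [k Hk]. exists (to_nat (m, S k)). now rewrite cancel_of_to. }
  destruct (H (proj1_sig b)) as [e He]. exists (fun n => to_omega1 (e n)).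
  intros [a Ha] Hab. destruct (He a Hab) as [n [H1 H2]]. exists n.
  unfold to_omega1.
  assert (E : canon (e n) = a) by (rewrite <- Ha; now apply canon_eq).
  generalize (canon_idem (e n)). rewrite E. intros Hp. f_equal. apply proof_irrelevance.
Qed.

(** One witness is chosen for each satisfiable statement, and all of them are bounded at once. In
    this way the countability of the set of conditions yields bounds in [Omega1]. *)
Lemma omega1_bound (I : Type) (Q : I -> Omega1 -> Prop) :
  countable I -> exists b, forall i, (exists a, Q i a) -> exists a, olt a b /\ Q i a.
Proof.
  intros HI.
  destruct (fun_choice _ _ (fun i a => (exists a, Q i a) -> Q i a)) as [f Hf].
  { intros i. destruct (classic (exists a, Q i a)) as [[a Ha]|H]; [eauto|].
    exists (to_omega1 Zero). tauto. }
  destruct (omega1_sup I f HI) as [b Hb]. exists b. intros i Hi. eauto.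
Qed.

Lemma omega1_succ (a : Omega1) : exists b, olt a b.
Proof. destruct (omega1_sup nat (fun _ => a) countable_nat) as [b Hb]. exists b. exact (Hb 0). Qed.

Lemma BP_ex_below (b : Omega1) (A : Omega1 -> Real -> Prop) :
  (forall a, olt a b -> BP (A a)) -> BP (fun x => exists a, olt a b /\ A a x).
Proof.
  intros H. destruct (omega1_segment b) as [e He].
  apply BP_iff with (A := fun x => exists n, olt (e n) b /\ A (e n) x).
  - intros x. split; [intros [n Hn]; eauto|].
    intros [a [Ha HA]]. destruct (He a Ha) as [n <-]. eauto.
  - apply BP_ex; [apply countable_nat|]. intros n.
    destruct (classic (olt (e n) b)) as [Hn|Hn].
    + apply BP_and; [apply BP_const|]. auto.
    + apply BP_iff with (A := fun _ => False); [tauto|]. apply BP_const.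
Qed.

Lemma BP_all_below (b : Omega1) (A : Omega1 -> Real -> Prop) :
  (forall a, olt a b -> BP (A a)) -> BP (fun x => forall a, olt a b -> A a x).
Proof.
  intros H. apply BP_iff with (A := fun x => ~ exists a, olt a b /\ ~ A a x).
  - intros x. split; [|firstorder]. intros Hn a Ha. apply NNPP. intros Hx. eauto.
  - apply BP_not, BP_ex_below. intros a Ha. apply BP_not; auto.
Qed.

(** * Transfinite runs *)

(** Numbering the tapes lets one argument treat all three; every index from 2 on means the output
    tape. *)
Definition cell (k n : nat) (c : Config) : bool :=
  match k with 0 => tape1 c n | 1 => tape2 c n | _ => tape3 c n end.

Lemma config_eq c d :
  st c = st d -> hd c = hd d -> (forall k n, cell k n c = cell k n d) -> c = d.
Proof.
  destruct c as [s h t1 t2 t3], d as [s' h' t1' t2' t3']; simpl; intros -> -> H.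
  f_equal; apply functional_extensionality; intros n.
  - exact (H 0 n).
  - exact (H 1 n).
  - exact (H 2 n).
Qed.

Lemma limit_rule_cell {T : Type} (lt : T -> T -> Prop) c t :
  limit_rule lt c t <-> st (c t) = 2 /\ hd (c t) = 0 /\
    forall k n, cell k n (c t) = true <-> limsup_true lt (fun u => cell k n (c u)) t.
Proof.
  unfold limit_rule. split.
  - intros (H1 & H2 & H3 & H4 & H5). repeat split; auto; intros;
      destruct k as [|[|k]]; simpl in *; firstorder.
  - intros (H1 & H2 & H3). split; [auto|split; [auto|]].
    split; [exact (H3 0)|split; [exact (H3 1)|exact (H3 2)]].
Qed.

Lemma bool_eq_iff (a b : bool) : (a = true <-> b = true) -> a = b.
Proof. destruct a, b; intuition congruence. Qed.

(** No halting clause: the run continues through the halting state, so it exists along every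
    well-order, and halting is read off as the first visit to state 1. *)
Definition is_run {T : Type} (P : Program) (lt : T -> T -> Prop) (c : T -> Config)
    (c0 : Config) : Prop :=
  (forall t, is_zero lt t -> c t = c0) /\
  (forall s t, is_pred lt s t -> c t = step P (c s)) /\
  (forall t, ~ is_zero lt t -> (forall s, ~ is_pred lt s t) -> limit_rule lt c t).

Lemma is_pred_unique {T : Type} (lt : T -> T -> Prop) s s' t :
  strict_well_order lt -> is_pred lt s t -> is_pred lt s' t -> s = s'.
Proof.
  intros (_ & _ & Htri & _) [H1 H2] [H3 H4].
  destruct (Htri s s') as [H|[H|H]]; auto; exfalso; firstorder.
Qed.

(** Well-founded recursion, with classical decisions on the kind of stage and on the bits at
    limits. *)
Lemma run_exists {T : Type} (lt : T -> T -> Prop) P c0 :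
  strict_well_order lt -> exists c, is_run P lt c c0.
Proof.
  intros Hswo. assert (Hwf : well_founded lt) by apply Hswo.
  set (limbit := fun (t : T) (rec : forall u, lt u t -> Config) k n =>
    if excluded_middle_informative
      (forall s, lt s t -> exists u (Hu : lt u t), (s = u \/ lt s u) /\ cell k n (rec u Hu) = true)
    then true else false).
  set (F := fun (t : T) (rec : forall u, lt u t -> Config) =>
    if excluded_middle_informative (is_zero lt t) then c0 else
    match excluded_middle_informative (exists s, is_pred lt s t) with
    | left H => let s := constructive_indefinite_description _ H in
                step P (rec (proj1_sig s) (proj1 (proj2_sig s)))
    | right _ => {| st := 2; hd := 0; tape1 := limbit t rec 0; tape2 := limbit t rec 1;
                    tape3 := limbit t rec 2 |}
    end).
  set (c := Fix Hwf (fun _ => Config) F).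
  assert (Hc : forall t, c t = F t (fun u _ => c u)).
  { intros t. unfold c. apply (Fix_eq Hwf (fun _ => Config) F). intros x f g Hfg. f_equal.
    apply functional_extensionality_dep; intros u.
    apply functional_extensionality_dep; intros Hu. apply Hfg. }
  exists c. split; [|split].
  - intros t Ht. rewrite Hc. unfold F.
    destruct (excluded_middle_informative _); tauto.
  - intros s t Hst. rewrite Hc. unfold F.
    destruct (excluded_middle_informative _) as [H|_]; [destruct (H s); apply Hst|].
    destruct (excluded_middle_informative _) as [H|H]; [|destruct H; eauto].
    do 2 f_equal. apply (is_pred_unique lt _ _ t Hswo); auto. apply proj2_sig.
  - intros t H1 H2. apply limit_rule_cell.
    assert (E : c t = {| st := 2; hd := 0; tape1 := limbit t (fun u _ => c u) 0;
      tape2 := limbit t (fun u _ => c u) 1; tape3 := limbit t (fun u _ => c u) 2 |}).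
    { rewrite Hc. unfold F at 1.
      destruct (excluded_middle_informative _) as [H|_]; [tauto|].
      destruct (excluded_middle_informative _) as [[s Hs]|_]; [destruct (H2 s Hs)|]. reflexivity. }
    rewrite E at 1 2. split; [reflexivity|split; [reflexivity|]].
    assert (Hb : forall k n, limbit t (fun u _ => c u) k n = true <->
              limsup_true lt (fun u => cell k n (c u)) t).
    { intros k n. unfold limbit, limsup_true.
      destruct (excluded_middle_informative _) as [H|H]; split; intros H'; try congruence.
      - intros s Hs. destruct (H s Hs) as (u & Hu & A1 & A2). eauto.
      - destruct H. intros s Hs. destruct (H' s Hs) as (u & A1 & Hu & A2). eauto. }
    intros k n. rewrite <- Hb, E. destruct k as [|[|k]]; reflexivity.
Qed.

(* [same_height t1 t2]: the strict initial segments below [t1] and [t2] are isomorphic. *)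
Inductive same_height {T1 T2 : Type} (lt1 : T1 -> T1 -> Prop) (lt2 : T2 -> T2 -> Prop) :
  T1 -> T2 -> Prop :=
| same_height_intro t1 t2 :
    (forall u1, lt1 u1 t1 -> exists u2, lt2 u2 t2 /\ same_height lt1 lt2 u1 u2) ->
    (forall u2, lt2 u2 t2 -> exists u1, lt1 u1 t1 /\ same_height lt1 lt2 u1 u2) ->
    same_height lt1 lt2 t1 t2.

Lemma same_height_fwd {T1 T2 : Type} (lt1 : T1 -> T1 -> Prop) (lt2 : T2 -> T2 -> Prop) t1 t2 :
  same_height lt1 lt2 t1 t2 ->
  forall u1, lt1 u1 t1 -> exists u2, lt2 u2 t2 /\ same_height lt1 lt2 u1 u2.
Proof. now intros []. Qed.

Lemma same_height_bwd {T1 T2 : Type} (lt1 : T1 -> T1 -> Prop) (lt2 : T2 -> T2 -> Prop) t1 t2 :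
  same_height lt1 lt2 t1 t2 ->
  forall u2, lt2 u2 t2 -> exists u1, lt1 u1 t1 /\ same_height lt1 lt2 u1 u2.
Proof. now intros []. Qed.

(** If neither position matches an earlier position of the other order, the induction hypotheses
    match the two initial segments. *)
Lemma same_height_trichotomy {T1 T2 : Type} (lt1 : T1 -> T1 -> Prop) (lt2 : T2 -> T2 -> Prop) :
  strict_well_order lt1 -> strict_well_order lt2 ->
  forall t1 t2, same_height lt1 lt2 t1 t2 \/
    (exists u1, lt1 u1 t1 /\ same_height lt1 lt2 u1 t2) \/
    (exists u2, lt2 u2 t2 /\ same_height lt1 lt2 t1 u2).
Proof.
  intros (_ & Ht1 & _ & Hw1) (_ & Ht2 & _ & Hw2).
  induction t1 as [t1 IH1] using (well_founded_ind Hw1).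
  induction t2 as [t2 IH2] using (well_founded_ind Hw2).
  destruct (classic (exists u1, lt1 u1 t1 /\ same_height lt1 lt2 u1 t2)) as [H1|H1]; auto.
  destruct (classic (exists u2, lt2 u2 t2 /\ same_height lt1 lt2 t1 u2)) as [H2|H2]; auto.
  left. constructor.
  - intros u1 Hu. destruct (IH1 u1 Hu t2) as [H|[[v [Hv H]]|H]]; auto; destruct H1; eauto.
  - intros u2 Hu. destruct (IH2 u2 Hu) as [H|[H|[v [Hv H]]]]; auto; destruct H2; eauto.
Qed.

Lemma same_height_unique {T1 T2 : Type} (lt1 : T1 -> T1 -> Prop) (lt2 : T2 -> T2 -> Prop) :
  strict_well_order lt1 -> strict_well_order lt2 ->
  forall t a b, same_height lt1 lt2 t a -> same_height lt1 lt2 t b -> a = b.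
Proof.
  intros (_ & _ & _ & Hw1) (Hi2 & _ & Htri & _).
  induction t as [t IH] using (well_founded_ind Hw1). intros a b Ha Hb.
  assert (H : forall a b, same_height lt1 lt2 t a -> same_height lt1 lt2 t b -> ~ lt2 a b).
  { clear a b Ha Hb. intros a b Ha Hb Hab.
    destruct Hb as [t b _ Hb]. destruct (Hb a Hab) as [u [Hu Hua]].
    destruct Ha as [t a Ha _]. destruct (Ha u Hu) as [v [Hv Huv]].
    rewrite (IH u Hu v a Huv Hua) in Hv. exact (Hi2 a Hv). }
  destruct (Htri a b) as [Hab|[Hab|Hab]]; auto; exfalso.
  - exact (H a b Ha Hb Hab).
  - exact (H b a Hb Ha Hab).
Qed.

Lemma same_height_sym {T1 T2 : Type} (lt1 : T1 -> T1 -> Prop) (lt2 : T2 -> T2 -> Prop) :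
  strict_well_order lt1 ->
  forall t a, same_height lt1 lt2 t a -> same_height lt2 lt1 a t.
Proof.
  intros (_ & _ & _ & Hw1).
  induction t as [t IH] using (well_founded_ind Hw1). intros a H.
  destruct H as [t a H1 H2]. constructor.
  - intros u Hu. destruct (H2 u Hu) as [v [Hv H]]. eauto.
  - intros u Hu. destruct (H1 u Hu) as [v [Hv H]]. eauto.
Qed.

Lemma same_height_lt {T1 T2 : Type} (lt1 : T1 -> T1 -> Prop) (lt2 : T2 -> T2 -> Prop) :
  strict_well_order lt1 -> strict_well_order lt2 ->
  forall t u a b, same_height lt1 lt2 t a -> same_height lt1 lt2 u b -> lt1 t u -> lt2 a b.
Proof.
  intros S1 S2 t u a b Ht Hu Htu. destruct Hu as [u b Hu _].
  destruct (Hu t Htu) as [v [Hv H]].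
  now rewrite (same_height_unique lt1 lt2 S1 S2 t a v Ht H).
Qed.

(** The configuration depends only on the height of the time, by induction. Hence a halting run
    along any well-order can be compared with the run along [Omega1]. *)
Lemma run_same_height {T1 T2 : Type} (lt1 : T1 -> T1 -> Prop) (lt2 : T2 -> T2 -> Prop)
    P c1 c2 c0 :
  strict_well_order lt1 -> strict_well_order lt2 ->
  is_run P lt1 c1 c0 -> is_run P lt2 c2 c0 ->
  forall t1 t2, same_height lt1 lt2 t1 t2 -> c1 t1 = c2 t2.
Proof.
  intros S1 S2 (Z1 & P1 & L1) (Z2 & P2 & L2).
  induction t1 as [t1 IH] using (well_founded_ind (proj2 (proj2 (proj2 S1)))).
  intros t2 Hs.
  pose proof (same_height_fwd _ _ _ _ Hs) as Hf. pose proof (same_height_bwd _ _ _ _ Hs) as Hb.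
  assert (Hlt : forall t u a b, same_height lt1 lt2 t a -> same_height lt1 lt2 u b ->
     (lt1 t u <-> lt2 a b)).
  { intros t u a b H1 H2. split.
    - apply (same_height_lt lt1 lt2 S1 S2); auto.
    - apply (same_height_lt lt2 lt1 S2 S1); now apply same_height_sym. }
  assert (Hpred : forall s1 s2, same_height lt1 lt2 s1 s2 ->
     (is_pred lt1 s1 t1 <-> is_pred lt2 s2 t2)).
  { intros s1 s2 H. unfold is_pred. rewrite (Hlt s1 t1 s2 t2 H Hs).
    split; intros [A1 A2]; split; auto; intros u [B1 B2].
    - destruct (Hb u B2) as [v [Hv Huv]]. apply (A2 v). split; auto. now apply (Hlt s1 v s2 u).
    - destruct (Hf u B2) as [v [Hv Huv]]. apply (A2 v). split; auto. now apply (Hlt s1 u s2 v). }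
  destruct (classic (is_zero lt1 t1)) as [H0|H0].
  { rewrite Z1, Z2; auto. intros u Hu. destruct (Hb u Hu) as [v [Hv _]]. eapply H0; eauto. }
  destruct (classic (exists s1, is_pred lt1 s1 t1)) as [[s1 Hp]|Hp].
  { destruct (Hf s1 (proj1 Hp)) as [s2 [Hs2 H]].
    rewrite (P1 s1 t1 Hp), (P2 s2 t2) by now apply (Hpred s1 s2).
    f_equal. apply IH; auto. apply Hp. }
  assert (R1 : limit_rule lt1 c1 t1) by (apply L1; eauto).
  assert (R2 : limit_rule lt2 c2 t2).
  { apply L2.
    - intros H. apply H0. intros u Hu. destruct (Hf u Hu) as [v [Hv _]]. eapply H; eauto.
    - intros s Hps. destruct (Hb s (proj1 Hps)) as [v [Hv H]]. apply Hp. exists v.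
      now apply (Hpred v s). }
  apply limit_rule_cell in R1, R2. destruct R1 as (A1 & A2 & A3), R2 as (B1 & B2 & B3).
  apply config_eq; try congruence. intros k n. apply bool_eq_iff.
  rewrite A3, B3. unfold limsup_true. split.
  - intros H s Hst. destruct (Hb s Hst) as [v [Hv Hvs]].
    destruct (H v Hv) as (u & E1 & E2 & E3). destruct (Hf u E2) as [w [Hw Huw]].
    exists w. rewrite <- (IH u E2 w Huw). repeat split; auto.
    destruct E1 as [<-|E1].
    + left. eapply (same_height_unique lt1 lt2); eauto.
    + right. now apply (Hlt v u s w).
  - intros H s Hst. destruct (Hf s Hst) as [v [Hv Hvs]].
    destruct (H v Hv) as (u & E1 & E2 & E3). destruct (Hb u E2) as [w [Hw Huw]].
    exists w. rewrite (IH w Hw u Huw). repeat split; auto.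
    destruct E1 as [<-|E1].
    + left. apply (same_height_unique lt2 lt1 S2 S1 v); now apply same_height_sym.
    + right. now apply (Hlt s w v u).
Qed.

Definition leq {T : Type} (lt : T -> T -> Prop) (s t : T) : Prop := s = t \/ lt s t.

Lemma leq_or_lt {T : Type} (lt : T -> T -> Prop) : strict_well_order lt ->
  forall s t, leq lt s t \/ lt t s.
Proof. intros (_ & _ & H & _) s t. unfold leq. destruct (H s t) as [?|[?|?]]; auto. Qed.

Lemma leq_trans {T : Type} (lt : T -> T -> Prop) : strict_well_order lt ->
  forall s t u, leq lt s t -> leq lt t u -> leq lt s u.
Proof. intros (_ & Ht & _) s t u [->|H1] [->|H2]; unfold leq; eauto. Qed.

Lemma leq_lt_trans {T : Type} (lt : T -> T -> Prop) : strict_well_order lt ->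
  forall s t u, leq lt s t -> lt t u -> lt s u.
Proof. intros (_ & Ht & _) s t u [->|H1] H2; eauto. Qed.

Lemma lt_leq_trans {T : Type} (lt : T -> T -> Prop) : strict_well_order lt ->
  forall s t u, lt s t -> leq lt t u -> lt s u.
Proof. intros (_ & Ht & _) s t u H1 [->|H2]; eauto. Qed.

Lemma lt_not_leq {T : Type} (lt : T -> T -> Prop) : strict_well_order lt ->
  forall s t, lt s t -> ~ leq lt t s.
Proof. intros (Hi & Ht & _) s t H1 [->|H2]; eapply Hi; eauto. Qed.

Lemma least_element {T : Type} (lt : T -> T -> Prop) (B : T -> Prop) :
  well_founded lt -> (exists t, B t) -> exists t, B t /\ forall u, lt u t -> ~ B u.
Proof.
  intros Hw [t Ht]. induction t as [t IH] using (well_founded_ind Hw).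
  destruct (classic (exists u, lt u t /\ B u)) as [[u [H1 H2]]|H]; [eauto|].
  exists t. split; auto. intros u Hu HB. eauto.
Qed.

(** * Final segments of a run, and loops *)

Definition upset {T : Type} (lt : T -> T -> Prop) (q : T) : Type := {t : T | leq lt q t}.

Definition upset_lt {T : Type} (lt : T -> T -> Prop) (q : T) (a b : upset lt q) : Prop :=
  lt (proj1_sig a) (proj1_sig b).

Lemma upset_swo {T : Type} (lt : T -> T -> Prop) (q : T) :
  strict_well_order lt -> strict_well_order (upset_lt lt q).
Proof.
  intros (Hi & Ht & Htri & Hw). split; [|split; [|split]].
  - intros a. apply Hi.
  - intros a b c. apply Ht.
  - intros [a Ha] [b Hb]. unfold upset_lt; simpl. destruct (Htri a b) as [H|[H|H]]; auto.
    subst b. right; left. f_equal. apply proof_irrelevance.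
  - exact (wf_inverse_image _ _ lt (@proj1_sig _ _) Hw).
Qed.

(** Limit stages see only cofinal behaviour, so cutting off the times before [q] does not change the
    limsup there. *)
Lemma upset_run {T : Type} (lt : T -> T -> Prop) P c c0 (q : T) :
  strict_well_order lt -> is_run P lt c c0 ->
  is_run P (upset_lt lt q) (fun a => c (proj1_sig a)) (c q).
Proof.
  intros S (_ & HP & HL). assert (Ht : forall a b c, lt a b -> lt b c -> lt a c) by apply S.
  assert (Hq : leq lt q q) by now left.
  assert (HPr : forall (s t : upset lt q), is_pred (upset_lt lt q) s t ->
                is_pred lt (proj1_sig s) (proj1_sig t)).
  { intros s t [H1 H2]. split; [exact H1|]. intros u [H3 H4].
    assert (Hu : leq lt q u).
    { eapply leq_trans; [exact S|exact (proj2_sig s)|]. now right. }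
    exact (H2 (exist _ u Hu) (conj H3 H4)). }
  split; [|split].
  - intros [t Htq] H. simpl. destruct Htq as [->|Hlt]; auto.
    destruct (H (exist _ q Hq)). exact Hlt.
  - intros s t H. apply HP. now apply HPr.
  - intros [t Htq] H1 H2.
    assert (Hqt : lt q t).
    { destruct Htq as [E|Hlt]; auto. subst t. destruct H1. intros [u Hu] Hlt.
      exact (lt_not_leq lt S _ _ Hlt Hu). }
    assert (R : limit_rule lt c t).
    { apply HL.
      - intros H. exact (H q Hqt).
      - intros s [Hs Hn].
        assert (Hsq : leq lt q s).
        { destruct (leq_or_lt lt S q s) as [H|H]; auto. destruct (Hn q). auto. }
        apply (H2 (exist _ s Hsq)). split; [exact Hs|]. intros u. apply Hn. }
    apply limit_rule_cell in R. apply limit_rule_cell. destruct R as (A1 & A2 & A3).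
    simpl. split; auto. split; auto. intros k n. rewrite A3. unfold limsup_true. split.
    + intros H [s Hs] Hst. destruct (H s Hst) as (u & E1 & E2 & E3).
      assert (Hu : leq lt q u) by (eapply leq_trans; [exact S|exact Hs|exact E1]).
      exists (exist _ u Hu). simpl. split; auto. destruct E1 as [->|E1]; [left|now right].
      f_equal. apply proof_irrelevance.
    (* A time before [q] may be replaced by [q] itself. *)
    + intros H s Hst. destruct (leq_or_lt lt S q s) as [Hs|Hs].
      * destruct (H (exist _ s Hs) Hst) as ([u Hu] & E1 & E2 & E3).
        exists u. split; auto. destruct E1 as [E1|E1]; [left|now right]. congruence.
      * destruct (H (exist _ q Hq) Hqt) as ([u Hu] & E1 & E2 & E3).
        exists u. split; auto. right. eapply lt_leq_trans; eauto.
Qed.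

(* A limit configuration that recurs is not yet a loop: a cell showing 0 at [d] might show
   1 somewhere in between, which would make it 1 at the next limit of recurrences. *)
Lemma run_loop {T : Type} (lt : T -> T -> Prop) P c c0 d d' :
  strict_well_order lt -> is_run P lt c c0 -> limit_rule lt c d -> lt d d' -> c d' = c d ->
  (forall v, leq lt d v -> leq lt v d' ->
     forall k n, cell k n (c d) = false -> cell k n (c v) = false) ->
  forall t, leq lt d t -> exists u, leq lt u d' /\ c t = c u.
Proof.
  intros S Hrun Hlim Hdd Hcd Hz t Hdt.
  pose proof Hrun as (_ & HP & HL).
  (* Stages where the run is back in the configuration of [d] and has kept every 0 of [d] in
     between. *)
  set (restart := fun q => leq lt d q /\ c q = c d /\
    forall v, leq lt d v -> leq lt v q ->
      forall k n, cell k n (c d) = false -> cell k n (c v) = false).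
  assert (Hrd : restart d).
  { split; [now left|split; [reflexivity|]]. intros v H1 [->|H2]; auto.
    destruct (lt_not_leq lt S _ _ H2 H1). }
  (* [m] is the supremum of the restarts up to [t]. *)
  destruct (least_element lt (fun u => forall q, restart q -> leq lt q t -> leq lt q u))
    as [m [Hm Hmin]]; [apply S|exists t; auto|].
  assert (Hdm : leq lt d m) by auto.
  assert (Hmt : leq lt m t).
  { destruct (leq_or_lt lt S m t) as [H|H]; auto. destruct (Hmin t H). auto. }
  (* Otherwise [m] is a limit of restarts. Cells showing 1 at [d] show it again at cofinally many
     restarts and cells showing 0 keep it, so the configuration of [d] recurs at [m]. *)
  assert (Hrm : restart m).
  { apply NNPP. intros Hn.
    assert (Hcof : forall u, lt u m -> exists q, restart q /\ lt u q /\ lt q m).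
    { intros u Hu. apply NNPP. intros Hno. apply (Hmin u Hu). intros q Hq Hqt.
      destruct (leq_or_lt lt S q u) as [H|H]; auto. destruct Hno. exists q. split; auto.
      split; auto. destruct (Hm q Hq Hqt) as [->|]; tauto. }
    assert (Hdm' : lt d m) by (destruct Hdm as [<-|]; tauto).
    assert (R : limit_rule lt c m).
    { apply HL.
      - intros H. exact (H d Hdm').
      - intros s [Hs1 Hs2]. destruct (Hcof s Hs1) as (q & _ & H1 & H2). eapply Hs2; eauto. }
    apply limit_rule_cell in R, Hlim.
    destruct R as (A1 & A2 & A3), Hlim as (B1 & B2 & _).
    assert (Hpres : forall v, leq lt d v -> lt v m ->
       forall k n, cell k n (c d) = false -> cell k n (c v) = false).
    { intros v H1 H2. destruct (Hcof v H2) as (q & (_ & _ & Hq) & H3 & _).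
      apply Hq; auto. now right. }
    assert (E : c m = c d).
    { apply config_eq; try congruence. intros k n. destruct (cell k n (c d)) eqn:Ec.
      - apply A3. intros s Hs. destruct (Hcof s Hs) as (q & (_ & Hq & _) & H1 & H2).
        exists q. rewrite Hq. auto.
      - apply not_true_is_false. intros H. apply A3 in H.
        destruct (H d Hdm') as (u & E1 & E2 & E3).
        rewrite (Hpres u E1 E2 k n Ec) in E3. discriminate. }
    apply Hn. split; auto. split; auto. intros v H1 [->|H2]; [now rewrite E|auto]. }
  (* From [m] on the run copies the run from [d], so the position of [t] above [m] is compared with
     that of [d'] above [d]. *)
  pose proof (upset_swo lt m S) as Sm. pose proof (upset_swo lt d S) as Sd.
  pose proof (upset_run lt P c c0 m S Hrun) as Rm.
  pose proof (upset_run lt P c c0 d S Hrun) as Rd.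
  destruct Hrm as (_ & Em & Hpm). rewrite Em in Rm.
  pose proof (run_same_height _ _ P _ _ _ Sm Sd Rm Rd) as Heq.
  assert (Hd' : leq lt d d') by now right.
  destruct (same_height_trichotomy _ _ Sm Sd (exist _ t Hmt) (exist _ d' Hd'))
    as [H|[([q Hq] & Hqt & H)|([u Hu] & Hud & H)]].
  - exists d'. split; [now left|]. exact (Heq _ _ H).
  (* The copy [q] of [d'] would be a restart after [m] and before [t], against the choice of [m]. *)
  - exfalso. pose proof (Heq _ _ H) as Eq. simpl in Eq.
    assert (Hmq : lt m q).
    { destruct Hq as [<-|]; auto. exfalso.
      destruct (same_height_bwd _ _ _ _ H (exist _ d (or_introl eq_refl)) Hdd)
        as ([u Hu] & Hlt & _).
      exact (lt_not_leq lt S _ _ Hlt Hu). }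
    apply (lt_not_leq lt S _ _ Hmq). apply Hm; [|now right].
    split; [exact (leq_trans lt S _ _ _ Hdm Hq)|]. split; [congruence|].
    intros v H1 H2 k n Hc. destruct (leq_or_lt lt S v m) as [Hv|Hv]; [eauto|].
    destruct H2 as [->|H2]; [rewrite Eq, Hcd; exact Hc|].
    destruct (same_height_fwd _ _ _ _ H (exist _ v (or_intror Hv)) H2) as ([u Hu] & Hlt & Hs).
    apply Heq in Hs. simpl in Hs. rewrite Hs. apply Hz; auto. now right.
  - exists u. split; [now right|]. exact (Heq _ _ H).
Qed.

(** * Runs on generic inputs *)

Definition BPval {I : Type} (F : Real -> I) : Prop := forall v, BP (fun z => F z = v).

Lemma BPval_map {I J : Type} (F : Real -> I) (g : I -> J) :
  countable I -> BPval F -> BPval (fun z => g (F z)).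
Proof.
  intros HI HF v. apply BP_iff with (A := fun z => exists i, F z = i /\ g i = v).
  - intros z. split; [intros (i & -> & H); auto|eauto].
  - apply BP_ex; auto. intros i. apply BP_and; auto. apply BP_const.
Qed.

Lemma BPval_pair {I J : Type} (F : Real -> I) (G : Real -> J) :
  BPval F -> BPval G -> BPval (fun z => (F z, G z)).
Proof.
  intros HF HG [i j]. apply BP_iff with (A := fun z => F z = i /\ G z = j).
  - intros z. split; [intros [-> ->]; auto|intros H; now inversion H].
  - now apply BP_and.
Qed.

Lemma BPval_bool (F : Real -> bool) : BP (fun z => F z = true) -> BPval F.
Proof.
  intros H [|]; auto. apply BP_iff with (A := fun z => F z <> true).
  - intros z. apply not_true_iff_false.
  - now apply BP_not.
Qed.

Lemma BPval_apply {I : Type} (F : Real -> nat) (G : Real -> nat -> I) :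
  BPval F -> (forall n, BPval (fun z => G z n)) -> BPval (fun z => G z (F z)).
Proof.
  intros HF HG v. apply BP_iff with (A := fun z => exists n, F z = n /\ G z n = v).
  - intros z. split; [intros (i & -> & H); auto|eauto].
  - apply BP_ex; [apply countable_nat|]. intros n. apply BP_and; auto. apply HG.
Qed.

Lemma BPval_const {I : Type} (i : I) : BPval (fun _ => i).
Proof. intros v. apply BP_const. Qed.

Lemma BPval_eq {I : Type} (F G : Real -> I) : (forall z, F z = G z) -> BPval F -> BPval G.
Proof. intros H HF v. apply BP_iff with (A := fun z => F z = v); auto. intros z. now rewrite H. Qed.

Definition BPconf (F : Real -> Config) : Prop :=
  BPval (fun z => st (F z)) /\ BPval (fun z => hd (F z)) /\
  forall k n, BPval (fun z => cell k n (F z)).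

Lemma BPconf_step P F : BPconf F -> BPconf (fun z => step P (F z)).
Proof.
  intros (Hs & Hh & Hc).
  (* The transition reads only this countable-valued information; a cell after the step depends
     further only on its old value. *)
  set (view := fun c => (st c, hd c, cell 0 (hd c) c, cell 1 (hd c) c, cell 2 (hd c) c)).
  assert (Hv : BPval (fun z => view (F z))).
  { unfold view. repeat apply BPval_pair; auto;
      apply (BPval_apply (fun z => hd (F z)) (fun z n => cell _ n (F z))); auto. }
  assert (Cv : countable (nat * nat * bool * bool * bool)).
  { repeat apply countable_prod; auto using countable_nat, countable_bool. }
  split; [|split].
  - apply BPval_eq with (F := fun z => let '(s, h, b1, b2, b3) := view (F z) in
      let '(s', _, _, _, _) := delta P s b1 b2 b3 in s').
    + intros z. unfold view, step, cell.
      now destruct (delta _ _ _ _ _) as [[[[? ?] ?] ?] ?].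
    + now apply (BPval_map (fun z => view (F z)) (fun v => let '(s, h, b1, b2, b3) := v in
      let '(s', _, _, _, _) := delta P s b1 b2 b3 in s')).
  - apply BPval_eq with (F := fun z => let '(s, h, b1, b2, b3) := view (F z) in
      let '(_, _, _, _, m) := delta P s b1 b2 b3 in if m then S h else Nat.pred h).
    + intros z. unfold view, step, cell.
      now destruct (delta _ _ _ _ _) as [[[[? ?] ?] ?] ?].
    + now apply (BPval_map (fun z => view (F z)) (fun v => let '(s, h, b1, b2, b3) := v in
      let '(_, _, _, _, m) := delta P s b1 b2 b3 in if m then S h else Nat.pred h)).
  - intros k n.
    set (g := fun vb : (nat * nat * bool * bool * bool) * bool =>
      let '((s, h, b1, b2, b3), b) := vb in
      let '(_, w1, w2, w3, _) := delta P s b1 b2 b3 in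
      if n =? h then match k with 0 => w1 | 1 => w2 | _ => w3 end else b).
    apply BPval_eq with (F := fun z => g (view (F z), cell k n (F z))).
    + intros z. unfold g, view, step, cell, upd.
      destruct (delta _ _ _ _ _) as [[[[? ?] ?] ?] ?].
      destruct k as [|[|k]]; simpl; destruct (n =? hd (F z)); reflexivity.
    + apply (BPval_map (fun z => (view (F z), cell k n (F z))) g).
      * apply countable_prod; auto using countable_bool.
      * now apply BPval_pair.
Qed.

Lemma BP_limsup (b : Omega1 -> Real -> bool) (a : Omega1) :
  (forall u, olt u a -> BP (fun z => b u z = true)) ->
  BP (fun z => limsup_true olt (fun u => b u z) a).
Proof.
  intros H. apply BP_all_below. intros s Hs.
  apply BP_iff with (A := fun z => exists u, olt u a /\ (leq olt s u /\ b u z = true)).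
  - intros z. unfold leq. firstorder.
  - apply BP_ex_below. intros u Hu. apply BP_and; auto. apply BP_const.
Qed.

(** Transfinite induction: a step has countably many local cases, and a limsup at a countable stage
    quantifies over countably many earlier stages. *)
Lemma BPconf_run P (c : Real -> Omega1 -> Config) (i : Real -> Real) :
  (forall n, BP (fun z => i z n = true)) ->
  (forall z, is_run P olt (c z) (init_config (i z))) ->
  forall a, BPconf (fun z => c z a).
Proof.
  intros Hi Hrun. induction a as [a IH] using (well_founded_ind (proj2 (proj2 (proj2 olt_swo)))).
  destruct (classic (is_zero olt a)) as [H0|H0].
  { replace (fun z => c z a) with (fun z => init_config (i z))
      by (apply functional_extensionality; intros z; symmetry; now apply (Hrun z)).
    split; [exact (BPval_const 0)|split; [exact (BPval_const 0)|]].
    intros k n. destruct k as [|[|k]]; try exact (BPval_const false). apply BPval_bool, Hi. }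
  destruct (classic (exists s, is_pred olt s a)) as [[s Hs]|Hp].
  { replace (fun z => c z a) with (fun z => step P (c z s))
      by (apply functional_extensionality; intros z; symmetry; now apply (Hrun z)).
    apply BPconf_step, IH, Hs. }
  assert (R : forall z, limit_rule olt (c z) a) by (intros z; apply (Hrun z); eauto).
  split; [|split].
  - apply BPval_eq with (F := fun _ => 2); [|apply BPval_const].
    intros z. symmetry. apply (R z).
  - apply BPval_eq with (F := fun _ => 0); [|apply BPval_const].
    intros z. symmetry. apply (R z).
  - intros k n. apply BPval_bool.
    apply BP_iff with (A := fun z => limsup_true olt (fun u => cell k n (c z u)) a).
    + intros z. specialize (R z). apply limit_rule_cell in R. symmetry. apply R.
    + apply BP_limsup. intros u Hu. apply (IH u Hu).
Qed.

(** [d] is the least ordinal above the iterates of [g]. These are cofinal in it, so whatever happens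
    between each [b] and [g b] recurs unboundedly below [d]. *)
Lemma closure_point (g : Omega1 -> Omega1) (a : Omega1) : (forall b, olt b (g b)) ->
  exists (d : Omega1) (q : nat -> Omega1), q 0 = a /\ (forall n, q (S n) = g (q n)) /\
    (forall n, olt (q n) d) /\ (forall u, olt u d -> exists n, leq olt u (q n)).
Proof.
  intros Hg. set (q := fix q n := match n with 0 => a | S n => g (q n) end).
  destruct (least_element olt (fun d => forall n, olt (q n) d)) as [d [H1 H2]].
  - apply olt_swo.
  - apply omega1_sup, countable_nat.
  - exists d, q. repeat split; auto. intros u Hu. apply NNPP. intros Hn.
    apply (H2 u Hu). intros n. destruct (leq_or_lt olt olt_swo u (q n)) as [H|H]; auto.
    destruct Hn. eauto.
Qed.

(* The countable chain condition: the forced values of limsup stabilize below [Omega1]. *)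
Lemma recurrence (I : Type) (b : I -> Omega1 -> Real -> bool) :
  countable I -> (forall i a, BP (fun z => b i a z = true)) ->
  exists d d', olt d d' /\ (forall u, olt u d -> exists v, olt u v /\ olt v d) /\
    (exists u, olt u d) /\ (forall u, olt u d' -> exists v, olt u v /\ olt v d') /\
    forces [] (fun z => forall i,
      (limsup_true olt (fun u => b i u z) d <-> limsup_true olt (fun u => b i u z) d') /\
      (~ limsup_true olt (fun u => b i u z) d ->
       forall u, leq olt d u -> olt u d' -> b i u z = false)).
Proof.
  intros HI Hb. pose proof olt_swo as S.
  assert (HIl : countable (I * list bool)) by (apply countable_prod; auto using countable_list_bool).
  set (V := fun i a e z => exists u, olt u e /\ (leq olt a u /\ b i u z = true)).
  assert (HV : forall i a e, BP (V i a e)).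
  { intros i a e. apply BP_ex_below. intros u _. apply BP_and; auto. apply BP_const. }
  assert (Vmono : forall i a a' e e' z, leq olt a' a -> leq olt e e' -> V i a e z -> V i a' e' z).
  { intros i a a' e e' z H1 H2 (u & H3 & H4 & H5). exists u.
    split; [eapply lt_leq_trans; eauto|]. split; auto. eapply leq_trans; eauto. }
  (* Recurrence in terms of forcing: [s] forces a 1 at or after [a], before a fixed countable
     stage. *)
  set (St := fun a i s => exists e, forces s (V i a e)).
  assert (Smono : forall a a' i s, leq olt a' a -> St a i s -> St a' i s).
  { intros a a' i s H [e He]. exists e. eapply forces_mono; eauto.
    intros z _. apply Vmono; auto. now left. }
  (* There are countably many pairs of an index and a condition, so one [e] serves them all. *)
  assert (Hg : forall a, exists e, olt a e /\ forall i s, St a i s -> forces s (V i a e)).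
  { intros a.
    destruct (omega1_bound _ (fun p e => forces (snd p) (V (fst p) a e)) HIl) as [e0 He0].
    destruct (omega1_sup bool (fun x => if x then e0 else a) countable_bool) as [e He].
    exists e. split; [exact (He false)|]. intros i s Hs.
    destruct (He0 (i, s) Hs) as (e1 & H1 & H2). eapply forces_mono; eauto.
    intros z _. apply Vmono; [now left|]. right.
    apply S with e0; [exact H1|exact (He true)]. }
  destruct (fun_choice _ _ _ Hg) as [g Hg'].
  (* A pair that fails [St] at any stage already fails it before [a0], so from [a0] on [St] no
     longer changes. *)
  destruct (omega1_bound _ (fun p a => ~ St a (fst p) (snd p)) HIl) as [a0 Ha0].
  assert (Hst : forall a i s, St a0 i s -> St a i s).
  { intros a i s H. apply NNPP. intros Hn. destruct (Ha0 (i, s)) as (a1 & H1 & H2); [eauto|].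
    apply H2. simpl. eapply Smono; eauto. now right. }
  (* At a closure point of [g], every recurrence that is forced happens cofinally. *)
  assert (Hcl : forall a, exists d, olt a d /\
    (forall u, olt u d -> exists v, olt u v /\ olt v d) /\
    (forall i s, St a0 i s -> forces s (fun z => limsup_true olt (fun u => b i u z) d))).
  { intros a. destruct (closure_point g a) as (d & q & Q0 & QS & Q1 & Q2); [apply Hg'|].
    exists d. split; [rewrite <- Q0; auto|]. split.
    - intros u Hu. destruct (Q2 u Hu) as [n Hn]. exists (q (Datatypes.S n)). split; auto.
      eapply leq_lt_trans; eauto. rewrite QS. apply Hg'.
    - intros i s Hs.
      apply forces_mono with (A := fun z => forall n, V i (q n) (q (Datatypes.S n)) z).
      + apply forces_all; [apply countable_nat|]. intros n. rewrite QS. apply Hg'. auto.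
      + intros z _ Hz u Hu. destruct (Q2 u Hu) as [n Hn].
        destruct (Hz n) as (v & H1 & H2 & H3). exists v. repeat split; auto.
        * exact (leq_trans olt S _ _ _ Hn H2).
        * now apply S with (q (Datatypes.S n)). }
  destruct (Hcl a0) as (d & D1 & D2 & D3). destruct (Hcl d) as (d' & E1 & E2 & E3).
  exists d, d'. repeat split; auto; [now exists a0|].
  apply forces_all; auto. intros i. apply forces_dense. intros t _.
  destruct (classic (exists u, ext t u /\ St a0 i u)) as [(u & Hu & Hs)|Hn].
  - exists u. split; auto.
    eapply forces_mono; [exact (forces_and _ _ _ (D3 i u Hs) (E3 i u Hs))|].
    intros z _ [H1 H2]. tauto.
  - exists t. split; [apply ext_refl|].
    (* A condition forcing such a 1 would satisfy [St a0], so comeagerly no 1 appears from [a0] up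
       to [d']. *)
    assert (H : forces t (fun z => ~ V i a0 d' z)).
    { apply BP_no_extension; auto. intros u Hu Hf. apply Hn. exists u. split; auto. now exists d'. }
    eapply forces_mono; [exact H|]. intros z _ Hz.
    assert (N1 : ~ limsup_true olt (fun u => b i u z) d).
    { intros L. destruct (L a0 D1) as (u & H1 & H2 & H3). apply Hz. exists u.
      split; [now apply S with d|]. auto. }
    assert (N2 : ~ limsup_true olt (fun u => b i u z) d').
    { intros L. destruct (L a0) as (u & H1 & H2 & H3); [now apply S with d|].
      apply Hz. exists u. auto. }
    split; [tauto|]. intros _ u H1 H2. apply not_true_is_false. intros H3. apply Hz.
    exists u. repeat split; auto. right. eapply lt_leq_trans; eauto.
Qed.

(** The map [phi] carries all of Cantor space into [X], as the machine is only known to compute [f]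
    on [X]; category is applied to the argument of [phi]. *)
Lemma itt_output_BP (X : Real -> Prop) (f phi : Real -> Real) :
  itt_computable_on X f -> (forall z, X (phi z)) -> (forall n, BP (fun z => phi z n = true)) ->
  forall n, BP (fun z => f (phi z) n = true).
Proof.
  intros (P & p & _ & Hf) HX Hphi. pose proof olt_swo as S.
  assert (Hin : forall n, BP (fun z => join (phi z) p n = true)).
  { intros n. unfold join. destruct (Nat.even n); auto. apply BP_const. }
  destruct (fun_choice _ _ (fun z c => is_run P olt c (init_config (join (phi z) p)))) as [c Hc].
  { intros z. apply run_exists, S. }
  pose proof (BPconf_run P c _ Hin Hc) as HBP.
  destruct (recurrence (nat * nat) (fun i a z => cell (fst i) (snd i) (c z a)))
    as (d & d' & Hdd & Ld & Nd & Ld' & HR).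
  { apply countable_prod; apply countable_nat. }
  { intros [k n] a. apply (HBP a). }
  assert (Hlim : forall z e, (exists u, olt u e) ->
     (forall u, olt u e -> exists v, olt u v /\ olt v e) -> limit_rule olt (c z) e).
  { intros z e [u Hu] He. apply (Hc z).
    - intros H. exact (H u Hu).
    - intros s [H1 H2]. destruct (He s H1) as (v & Hv). exact (H2 v Hv). }
  intros n.
  (* Up to a meager set, the output is read at the first halting stage, and this comes no later than
     [d']. *)
  apply BP_almost with (A := fun z => exists a, leq olt a d' /\ st (c z a) = 1 /\
    (forall u, olt u a -> st (c z u) <> 1) /\ tape3 (c z a) n = true).
  - eapply forces_mono; [exact HR|]. intros z _ Hz.
    destruct (Hf _ (HX z)) as (T & lt & ct & top & ST & Htop & Z & Pr & L & Hbefore & Hhalt & Hout).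
    assert (Hrun : is_run P lt ct (init_config (join (phi z) p))) by (split; auto).
    assert (Heq := run_same_height lt olt P ct (c z) _ ST S Hrun (Hc z)).
    assert (Hfirst : forall a, same_height lt olt top a -> st (c z a) = 1 /\
      (forall u, olt u a -> st (c z u) <> 1) /\ forall n, tape3 (c z a) n = f (phi z) n).
    { intros a Ha. rewrite <- (Heq _ _ Ha). repeat split; auto. intros u Hu.
      destruct (same_height_bwd _ _ _ _ Ha u Hu) as (t & Ht & Htu).
      rewrite <- (Heq _ _ Htu). apply Hbefore. intros ->. exact (proj1 ST _ Ht). }
    assert (Ha : exists a, leq olt a d' /\ same_height lt olt top a).
    { destruct (same_height_trichotomy lt olt ST S top d') as [H|[(t' & Ht' & H)|(u & Hu & H)]].
      - exists d'. split; auto. now left.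
      (* If the machine halted only after the time [t'] of height [d'], the loop would give an
         earlier time the same halting configuration. *)
      - exfalso.
        destruct (same_height_bwd _ _ _ _ H d Hdd) as (t & Htt & Ht).
        assert (E : c z d' = c z d).
        { pose proof (Hlim z d Nd Ld) as R.
          assert (R' : limit_rule olt (c z) d') by (apply Hlim; eauto).
          apply limit_rule_cell in R, R'.
          destruct R as (A1 & A2 & A3), R' as (B1 & B2 & B3).
          apply config_eq; try congruence. intros k m. apply bool_eq_iff.
          rewrite A3, B3. symmetry. exact (proj1 (Hz (k, m))). }
        assert (Hpres : forall v, leq olt d v -> leq olt v d' ->
          forall k m, cell k m (c z d) = false -> cell k m (c z v) = false).
        { intros v H1 [->|H2] k m Hk; [now rewrite E|].
          apply (proj2 (Hz (k, m))); auto. intros Hl. simpl in Hl.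
          pose proof (Hlim z d Nd Ld) as R. apply limit_rule_cell in R. apply R in Hl. congruence. }
        destruct (run_loop lt P ct _ t t' ST Hrun) with (t := top) as (u & Hu & Hcu).
        + apply L.
          * intros H0. destruct Nd as [v Hv].
            destruct (same_height_bwd _ _ _ _ Ht v Hv) as (w & Hw & _). exact (H0 w Hw).
          * intros s [Hs1 Hs2]. destruct (same_height_fwd _ _ _ _ Ht s Hs1) as (v & Hv & Hsv).
            destruct (Ld v Hv) as (v' & V1 & V2).
            destruct (same_height_bwd _ _ _ _ Ht v' V2) as (w & Hw & Hwv).
            apply (Hs2 w). split; auto.
            apply (same_height_lt olt lt S ST v v'); auto; now apply same_height_sym.
        + exact Htt.
        + rewrite (Heq _ _ H), (Heq _ _ Ht). exact E.
        + intros v H1 H2 k m. rewrite (Heq _ _ Ht).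
          assert (Hv : exists w, leq olt w d' /\ leq olt d w /\ same_height lt olt v w).
          { destruct H2 as [->|H2]; [exists d'; split; [now left|split; [now right|exact H]]|].
            destruct (same_height_fwd _ _ _ _ H v H2) as (w & Hw & Hvw).
            exists w. split; [now right|]. split; auto. destruct H1 as [<-|H1].
            - left. exact (same_height_unique lt olt ST S t _ _ Ht Hvw).
            - right. exact (same_height_lt lt olt ST S t v _ _ Ht Hvw H1). }
          destruct Hv as (w & W1 & W2 & W3). rewrite (Heq _ _ W3). auto.
        + destruct (Htop t) as [->|]; [now left|now right].
        + apply (Hbefore u); [|now rewrite <- Hcu].
          intros ->. exact (lt_not_leq lt ST _ _ Ht' Hu).
      - exists u. split; auto. now right. }
    destruct Ha as (a & Had & Ha). destruct (Hfirst a Ha) as (H1 & H2 & H3). split.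
    + intros (a' & _ & K1 & K2 & K3). rewrite <- H3, <- K3. do 2 f_equal.
      destruct (proj1 (proj2 (proj2 S)) a a') as [H|[H|H]]; auto.
      * now destruct (K2 a H).
      * now destruct (H2 a' H).
    + intros H. exists a. rewrite H3. auto.
  (* A strict bound above [d'] turns the quantifier over stages into one over an initial segment,
     which is countable. *)
  - destruct (omega1_succ d') as [e He].
    apply BP_iff with (A := fun z => exists a, olt a e /\ (leq olt a d' /\ st (c z a) = 1 /\
      (forall u, olt u a -> st (c z u) <> 1) /\ cell 2 n (c z a) = true)).
    + intros z. split; [intros (a & _ & H); eauto|]. intros (a & H & H').
      exists a. split; [|auto]. eapply leq_lt_trans; eauto.
    + apply BP_ex_below. intros a _. repeat apply BP_and.
      * apply BP_const.
      * apply (HBP a).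
      * apply BP_all_below. intros u _. apply BP_not. apply (HBP u).
      * apply (HBP a).
Qed.

(** * Pairs of generic reals *)

(* A condition [(p, k)] approximates two reals by the two projections of [p] and promises
   that from now on they agree on all positions in rows below [k]. *)
Definition cond : Type := list (bool * bool) * nat.

Definition left_part (c : cond) : list bool := map fst (fst c).
Definition right_part (c : cond) : list bool := map snd (fst c).

(** With [le] for [kle], promises may be extended to further rows; with [eq], the rows from [snd c]
    on stay free forever. *)
Definition cond_le (row : nat -> nat) (kle : nat -> nat -> Prop) (c d : cond) : Prop :=
  ext (fst c) (fst d) /\ kle (snd c) (snd d) /\
  forall j, length (fst c) <= j < length (fst d) -> row j < snd c ->
    nth j (left_part d) false = nth j (right_part d) false.

Definition approximates (row : nat -> nat) (c : cond) (x y : Real) : Prop :=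
  pre (left_part c) x /\ pre (right_part c) y /\
  forall j, length (fst c) <= j -> row j < snd c -> x j = y j.

Lemma left_part_length c : length (left_part c) = length (fst c).
Proof. apply length_map. Qed.

Lemma right_part_length c : length (right_part c) = length (fst c).
Proof. apply length_map. Qed.

Lemma ext_map {X Y : Type} (f : X -> Y) s t : ext s t -> ext (map f s) (map f t).
Proof. intros [u ->]. exists (map f u). apply map_app. Qed.

Lemma cond_le_refl row (kle : nat -> nat -> Prop) : (forall k, kle k k) ->
  forall c, cond_le row kle c c.
Proof. intros H c. split; [apply ext_refl|]. split; auto. intros j Hj. lia. Qed.

Lemma cond_le_trans row (kle : nat -> nat -> Prop) :
  (forall a b c, kle a b -> kle b c -> kle a c) -> (forall a b, kle a b -> a <= b) ->
  forall c d e, cond_le row kle c d -> cond_le row kle d e -> cond_le row kle c e.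
Proof.
  intros Ht Hle c d e (E1 & K1 & A1) (E2 & K2 & A2).
  split; [eapply ext_trans; eauto|]. split; [eauto|]. intros j Hj Hr.
  destruct (Nat.lt_ge_cases j (length (fst d))) as [H|H].
  - rewrite (ext_nth false (left_part d) (left_part e)),
      (ext_nth false (right_part d) (right_part e));
      try (now apply ext_map); try (unfold left_part, right_part; rewrite length_map; lia).
    apply A1; auto. lia.
  - apply A2; [lia|]. apply Hle in K1. lia.
Qed.

(** Equal bits on both sides break no promise, so either side can be steered into a dense set by
    copying the new bits to the other. *)
Lemma cond_duplicate row (kle : nat -> nat -> Prop) c u : (forall k, kle k k) ->
  let d := (fst c ++ map (fun b => (b, b)) u, snd c) in
  cond_le row kle c d /\ left_part d = left_part c ++ u /\ right_part d = right_part c ++ u.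
Proof.
  intros Hk d.
  assert (El : left_part d = left_part c ++ u).
  { unfold left_part, d. simpl. rewrite map_app, map_map. simpl. now rewrite map_id. }
  assert (Er : right_part d = right_part c ++ u).
  { unfold right_part, d. simpl. rewrite map_app, map_map. simpl. now rewrite map_id. }
  split; [|auto]. split; [now eexists|]. split; [apply Hk|]. intros j Hj _. rewrite El, Er.
  rewrite !app_nth2; rewrite ?left_part_length, ?right_part_length; try lia. reflexivity.
Qed.

(** The dense sets of [C] are met on one side at a time, so both reals lie in [C] while the pair
    keeps its promises and meets the requirements [Q]. *)
Lemma generic_pair row (kle : nat -> nat -> Prop) (C : Real -> Prop) (c0 : cond)
    (Q : nat -> cond -> Prop) :
  (forall k, kle k k) -> (forall a b c, kle a b -> kle b c -> kle a c) ->
  (forall a b, kle a b -> a <= b) -> forces [] C ->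
  (forall j c, cond_le row kle c0 c -> exists d, cond_le row kle c d /\ Q j d) ->
  exists x y, C x /\ C y /\ approximates row c0 x y /\
    forall j, exists c, Q j c /\ approximates row c x y.
Proof.
  intros Kr Kt Kle (D & D1 & D2) HQ.
  pose proof (cond_le_refl row kle Kr) as Cr.
  pose proof (cond_le_trans row kle Kt Kle) as Ct.
  assert (Hl : forall c d, cond_le row kle c d -> ext (left_part c) (left_part d))
    by (intros c d H; apply ext_map, H).
  assert (Hr : forall c d, cond_le row kle c d -> ext (right_part c) (right_part d))
    by (intros c d H; apply ext_map, H).
  destruct (generic_sequence cond (cond_le row kle) (fun n c =>
    (exists u, ext u (left_part c) /\ D n u) /\ (exists u, ext u (right_part c) /\ D n u) /\
    (exists d, cond_le row kle d c /\ Q n d) /\ n <= length (fst c)) c0)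
    as (q & Q0 & QS & QD); eauto.
  (* One stage: steer the left side, then the right side, then meet [Q n], then lengthen. *)
  { intros n c Hc.
    destruct (D1 n (left_part c)) as (w1 & [u1 ->] & Hw1); [apply ext_nil|].
    destruct (cond_duplicate row kle c u1 Kr) as (L1 & E1 & _).
    set (c1 := (fst c ++ _, snd c)) in *.
    destruct (D1 n (right_part c1)) as (w2 & [u2 ->] & Hw2); [apply ext_nil|].
    destruct (cond_duplicate row kle c1 u2 Kr) as (L2 & _ & E2).
    set (c2 := (fst c1 ++ _, snd c1)) in *.
    destruct (HQ n c2) as (c3 & L3 & Hc3); [eauto|].
    destruct (cond_duplicate row kle c3 (repeat false n) Kr) as (L4 & E4 & _).
    set (c4 := (fst c3 ++ _, snd c3)) in *.
    exists c4. split; [eauto|]. split; [|split; [|split]].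
    - exists (left_part c1). split; [eauto|]. now rewrite E1.
    - exists (right_part c2). split; [eauto|]. now rewrite E2.
    - eauto.
    - rewrite <- left_part_length, E4, length_app, repeat_length. lia. }
  pose proof (chain_le cond (cond_le row kle) q Cr Ct QS) as Hchain.
  destruct (chain_limit (fun n => left_part (q n))) as [x Hx].
  { intros n. apply Hl, QS. } { intros n. rewrite left_part_length. apply QD. }
  destruct (chain_limit (fun n => right_part (q n))) as [y Hy].
  { intros n. apply Hr, QS. } { intros n. rewrite right_part_length. apply QD. }
  assert (Happ : forall c n, cond_le row kle c (q n) -> approximates row c x y).
  { intros c n Hc. split; [eapply pre_ext; [apply Hl|]; eauto|].
    split; [eapply pre_ext; [apply Hr|]; eauto|]. intros j Hj Hk.
    (* The condition [q m] extends [c] and is long enough to contain position [j]. *)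
    set (m := Nat.max n (S j)).
    assert (Hm : cond_le row kle c (q m)) by (eapply Ct; [exact Hc|apply Hchain; lia]).
    assert (Hlen : m <= length (fst (q m))) by apply QD.
    rewrite <- (Hx m j), <- (Hy m j); rewrite ?left_part_length, ?right_part_length; try lia.
    apply Hm; auto. lia. }
  exists x, y. split; [|split; [|split]].
  - apply D2; [apply pre_nil|]. intros j. destruct (QD j) as ((u & Hu & Du) & _).
    exists u. split; auto. eapply pre_ext; eauto.
  - apply D2; [apply pre_nil|]. intros j. destruct (QD j) as (_ & (u & Hu & Du) & _).
    exists u. split; auto. eapply pre_ext; eauto.
  - eauto.
  - intros j. destruct (QD j) as (_ & _ & (d & Hd & HQd) & _). eauto.
Qed.

Definition zip_prefix (x y : Real) (n : nat) : list (bool * bool) :=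
  map (fun i => (x i, y i)) (seq 0 n).

Lemma zip_prefix_parts x y n k :
  left_part (zip_prefix x y n, k) = prefix x n /\ right_part (zip_prefix x y n, k) = prefix y n.
Proof. unfold left_part, right_part, zip_prefix, prefix. simpl. now rewrite !map_map. Qed.

(** Leads back from a pair of reals to conditions: what long prefixes of the pair decide is decided
    by an extension of [c]. *)
Lemma approximates_zip_prefix row c x y n :
  approximates row c x y -> length (fst c) <= n ->
  cond_le row le c (zip_prefix x y n, snd c).
Proof.
  intros (H1 & H2 & H3) Hn. destruct (zip_prefix_parts x y n (snd c)) as [El Er].
  assert (Hlen : length (zip_prefix x y n) = n)
    by (unfold zip_prefix; now rewrite length_map, length_seq).
  split; [|split; [simpl; lia|]].
  - apply (ext_of_nth (false, false)); simpl; [lia|]. intros i Hi.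
    unfold zip_prefix.
    rewrite (nth_indep (map _ _)) with (d' := (x 0, y 0)) by (rewrite length_map, length_seq; lia).
    rewrite map_nth with (f := fun i => (x i, y i)), seq_nth by lia. simpl.
    rewrite <- H1 by now rewrite left_part_length.
    rewrite <- H2 by now rewrite right_part_length.
    unfold left_part, right_part.
    rewrite (map_nth fst (fst c) (false, false) i : nth i (map fst (fst c)) false = _).
    rewrite (map_nth snd (fst c) (false, false) i : nth i (map snd (fst c)) false = _).
    now destruct (nth i (fst c) (false, false)).
  - rewrite El, Er. simpl. intros j Hj Hr. rewrite Hlen in Hj. rewrite !prefix_nth by lia.
    apply H3; auto. lia.
Qed.

Definition decides (h : Real -> Real) (s : list bool) (n : nat) (v : bool) : Prop :=
  forces s (fun x => h x n = v).

(** The truth lemma for the bits of [h x], as a property of [x]. All long prefixes must decide, so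
    that two reals can use prefixes of a common length. *)
Definition generic_for (h : Real -> Real) (x : Real) : Prop :=
  (forall s n v, pre s x -> decides h s n v -> h x n = v) /\
  (forall n, exists l, forall m, l <= m -> decides h (prefix x m) n (h x n)).

Lemma forces_generic (h : Real -> Real) :
  (forall n, BP (fun x => h x n = true)) -> forces [] (generic_for h).
Proof.
  intros Hb. apply forces_and.
  - apply forces_all; [apply countable_list_bool|]. intros s.
    apply forces_all; [apply countable_nat|]. intros n.
    apply forces_all; [apply countable_bool|]. intros v.
    destruct (classic (decides h s n v)) as [H|H].
    + eapply forces_mono; [apply (forces_below [] s _ H)|]. auto.
    + apply forces_true. tauto.
  - apply forces_all; [apply countable_nat|]. intros n. apply forces_dense. intros t _.
    assert (H : exists u v, ext t u /\ decides h u n v).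
    { destruct (Hb n t) as (u & Hu & [H|H]); exists u; [exists true|exists false]; split; auto.
      eapply forces_mono; [exact H|]. intros x _. apply not_true_is_false. }
    destruct H as (u & v & Hu & Hd). exists u. split; auto.
    eapply forces_mono; [exact Hd|]. intros x Hx Hv. exists (length u). intros m Hm.
    rewrite Hv. eapply forces_ext; [exact Hd|].
    apply (pre_cmp u _ x); auto using prefix_pre. now rewrite prefix_length.
Qed.

(** * Non-reductions of Baire-measurable maps *)

(** Beyond any [N] a condition can be extended by a bit that differs from [y], so [E0]-classes are
    meager. *)
Lemma forces_not_E0 s y : forces s (fun x => ~ E0 x y).
Proof.
  apply forces_mono with (A := fun x => forall N, exists n, N <= n /\ x n <> y n).
  2: { intros x _ H [N HN]. destruct (H N) as (n & H1 & H2). auto. }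
  apply forces_all; [apply countable_nat|]. intros N.
  exists (fun _ u => exists n, N <= n /\ n < length u /\ nth n u false <> y n). split.
  - intros _ t _. destruct (ext_longer t N) as (u & Hu & Hl).
    exists (u ++ [negb (y (length u))]). split; [eapply ext_trans; [exact Hu|]; now eexists|].
    exists (length u). rewrite length_app, nth_middle. simpl. split; auto. split; [lia|].
    now destruct (y (length u)).
  - intros x _ H. destruct (H 0) as (u & Hu & n & H1 & H2 & H3). exists n. split; auto.
    now rewrite <- (Hu n H2).
Qed.

Lemma E0_not_to_eq (h : Real -> Real) :
  (forall n, BP (fun x => h x n = true)) ->
  ~ (forall x y, E0 x y <-> real_eq (h x) (h y)).
Proof.
  intros Hb Hred. pose proof (forces_generic h Hb) as HG.
  destruct (forces_inhabited _ _ HG) as (x & _ & Gx).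
  destruct (forces_inhabited _ _ (forces_and _ _ _ HG (forces_not_E0 [] x))) as (y & _ & Gy & Hxy).
  (* The inequivalent generics [x] and [y] are shown to have the same image. *)
  apply Hxy, Hred. intros n.
  destruct (proj2 Gx n) as [l1 H1], (proj2 Gy n) as [l2 H2].
  set (m := Nat.max l1 l2). specialize (H1 m). specialize (H2 m).
  (* Equally long conditions have a common generic continuation, so they decide alike. *)
  destruct (generic_pair (fun _ => 0) le (generic_for h) (zip_prefix x y m, 1) (fun _ _ => True))
    as (x' & y' & Gx' & Gy' & (A1 & A2 & A3) & _); auto; try lia.
  { intros _ c _. exists c. split; auto. apply cond_le_refl. auto. }
  destruct (zip_prefix_parts x y m 1) as [El Er]. rewrite El in A1. rewrite Er in A2.
  rewrite <- (proj1 Gx' _ _ _ A1 (H1 ltac:(lia))), <- (proj1 Gy' _ _ _ A2 (H2 ltac:(lia))).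
  (* Every position lies in row 0, below the promised bound 1, so [x'] and [y'] agree beyond the
     condition. *)
  symmetry. apply Hred. exists (length (zip_prefix x y m)). intros j Hj. apply A3; auto.
Qed.

Definition E3 (x y : Real) : Prop := forall i, E0 (seq_elem x i) (seq_elem y i).

(** The coding uses Cantor's pairing, so [of_nat] decodes it. *)
Lemma pair_to_nat n m : pair n m = to_nat (n, m).
Proof.
  pose proof (to_nat_spec n m) as H. unfold pair.
  replace ((n + m) * (n + m + 1)) with ((to_nat (n, m) - m) * 2) by nia.
  rewrite Nat.div_mul by lia. nia.
Qed.

Definition row (j : nat) : nat := fst (of_nat j).

Lemma row_pair i k : row (pair i k) = i.
Proof. unfold row. now rewrite pair_to_nat, cancel_of_to. Qed.

Lemma pair_ge i k : k <= pair i k.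
Proof. unfold pair. lia. Qed.

Lemma E3_not_to_E0 (h : Real -> Real) :
  (forall n, BP (fun x => h x n = true)) -> ~ (forall x y, E3 x y <-> E0 (h x) (h y)).
Proof.
  intros Hb Hred. pose proof (forces_generic h Hb) as HG.
  (* The dichotomy is whether every condition has extensions whose two sides decide opposite image
     bits arbitrarily late. *)
  destruct (classic (forall c N, exists d n v, cond_le row le c d /\ N <= n /\
    decides h (left_part d) n v /\ decides h (right_part d) n (negb v))) as [H|H].
  - destruct (generic_pair row le (generic_for h) ([], 0) (fun N d => N <= snd d /\
      exists n v, N <= n /\ decides h (left_part d) n v /\ decides h (right_part d) n (negb v)))
      as (x & y & Gx & Gy & _ & HQ); auto; try lia.
    (* The promise is raised to [N] rows first, so that in the limit every row agrees from some
       position on. *)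
    { intros N c _. set (c' := (fst c, Nat.max (snd c) N)).
      assert (Hc : cond_le row le c c').
      { split; [apply ext_refl|]. split; [simpl; lia|]. simpl. lia. }
      destruct (H c' N) as (d & n & v & Hd & Hn & Hv). exists d. split.
      - eapply cond_le_trans; eauto; lia.
      - split; [|eauto]. destruct Hd as (_ & Hd & _). simpl in Hd. lia. }
    assert (HE : E3 x y).
    { intros i. destruct (HQ (S i)) as (c & (Hk & _) & (_ & _ & Hc)).
      exists (length (fst c)). intros k Hlk. apply Hc; [|rewrite row_pair; lia].
      pose proof (pair_ge i k). lia. }
    apply Hred in HE. destruct HE as [N HN].
    destruct (HQ N) as (c & (_ & n & v & Hn & V1 & V2) & (A1 & A2 & _)).
    specialize (HN n Hn). rewrite (proj1 Gx _ _ _ A1 V1), (proj1 Gy _ _ _ A2 V2) in HN.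
    now destruct v.
  - apply not_all_ex_not in H. destruct H as [c H].
    apply not_all_ex_not in H. destruct H as [N H].
    (* Row [k] is the first about which [c] promises nothing. With the promise frozen, a generic
       pair below [c] is made to differ infinitely often in this row. *)
    set (k := snd c).
    destruct (generic_pair row eq (generic_for h) c (fun N d => exists m, N <= m /\
      pair k m < length (fst d) /\
      nth (pair k m) (left_part d) false <> nth (pair k m) (right_part d) false))
      as (x & y & Gx & Gy & Hc & HQ); auto; try congruence; try lia.
    { intros M d (_ & Hk & _).
      (* As [m <= pair k m], this position is still undetermined by [d]. *)
      set (m := M + length (fst d)). pose proof (pair_ge k m) as Hm.
      set (u := repeat false (pair k m - length (fst d))).
      destruct (cond_duplicate row eq d u) as (L1 & El & Er); [auto|].
      set (d1 := (fst d ++ _, snd d)) in *.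
      assert (Hlen : length (fst d1) = pair k m).
      { rewrite <- left_part_length, El, length_app, left_part_length. unfold u.
        rewrite repeat_length. lia. }
      set (d2 := (fst d1 ++ [(true, false)], snd d1)).
      exists d2. split.
      - eapply cond_le_trans; [congruence|lia|exact L1|].
        split; [now eexists|]. split; [reflexivity|].
        change (fst d2) with (fst d1 ++ [(true, false)]). rewrite length_app. cbn [length].
        intros j Hj Hr. exfalso. replace j with (pair k m) in Hr by lia.
        rewrite row_pair in Hr. change (snd d1) with (snd d) in Hr.
        unfold k in Hr. rewrite <- Hk in Hr. lia.
      - exists m. split; [lia|]. unfold left_part, right_part.
        change (fst d2) with (fst d1 ++ [(true, false)]).
        rewrite length_app, <- Hlen, !map_app. cbn [length map fst snd]. split; [lia|].
        rewrite !app_nth2; rewrite ?length_map; try lia. rewrite !Nat.sub_diag. simpl. congruence. }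
    assert (Hn : ~ E3 x y).
    { intros HE. destruct (HE k) as [M HM]. destruct (HQ M) as (d & (m & H1 & H2 & H3) & (A1 & A2 & _)).
      apply H3. rewrite A1, A2; rewrite ?left_part_length, ?right_part_length; auto.
      exact (HM m H1). }
    (* A disagreement of the images from [N] on would be decided by long prefixes, yielding an
       extension of [c] that was excluded. *)
    apply Hn, Hred. exists N. intros n Hn'. apply NNPP. intros Hxy. apply H.
    destruct (proj2 Gx n) as [l1 H1], (proj2 Gy n) as [l2 H2].
    set (m := length (fst c) + l1 + l2).
    exists (zip_prefix x y m, k), n, (h x n).
    destruct (zip_prefix_parts x y m k) as [El Er]. rewrite El, Er.
    split; [apply approximates_zip_prefix; auto; lia|]. split; auto.
    split; [apply H1; lia|]. replace (negb (h x n)) with (h y n); [apply H2; lia|].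
    destruct (h x n), (h y n); simpl; congruence.
Qed.

(** The guard [m <> n] is there because codes are reflexive orders. An upper bound on the rank
    unfolds into countable quantifiers and so keeps the Baire property. *)
Inductive rank_le (y : Real) : nat -> Omega1 -> Prop :=
| rank_le_intro n a :
    (forall m, rel y m n -> m <> n -> exists b, olt b a /\ rank_le y m b) -> rank_le y n a.

Definition rank_is (y : Real) (n : nat) (a : Omega1) : Prop :=
  rank_le y n a /\ forall b, olt b a -> ~ rank_le y n b.

Definition otype_le (y : Real) (g : Omega1) : Prop :=
  forall n, field y n -> exists b, olt b g /\ rank_le y n b.

Definition otype_is (y : Real) (g : Omega1) : Prop :=
  otype_le y g /\ forall g', olt g' g -> ~ otype_le y g'.

Lemma rank_le_inv y n a : rank_le y n a ->
  forall m, rel y m n -> m <> n -> exists b, olt b a /\ rank_le y m b.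
Proof. now intros []. Qed.

Lemma rank_le_mono y n a b : rank_le y n a -> leq olt a b -> rank_le y n b.
Proof.
  intros [n' a' H] Hab. constructor. intros m H1 H2. destruct (H m H1 H2) as (e & He & Hr).
  exists e. split; auto. eapply lt_leq_trans; eauto using olt_swo.
Qed.

Lemma rank_is_unique y n a b : rank_is y n a -> rank_is y n b -> a = b.
Proof.
  intros [H1 H2] [H3 H4]. destruct (proj1 (proj2 (proj2 olt_swo)) a b) as [H|[H|H]]; auto.
  - now destruct (H4 a H).
  - now destruct (H2 b H).
Qed.

Lemma rank_exists y g n : otype_le y g -> field y n -> exists a, olt a g /\ rank_is y n a.
Proof.
  intros Hg Hn. destruct (least_element olt (rank_le y n)) as (a & H1 & H2).
  - apply olt_swo.
  - destruct (Hg n Hn) as (b & _ & Hb). eauto.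
  - exists a. split; [|now split]. destruct (Hg n Hn) as (b & Hbg & Hb).
    destruct (leq_or_lt olt olt_swo a b) as [H|H]; [|now destruct (H2 b H)].
    eapply leq_lt_trans; eauto using olt_swo.
Qed.

Lemma rank_lt y m n a b : rel y m n -> m <> n -> rank_is y m a -> rank_is y n b -> olt a b.
Proof.
  intros H1 H2 [_ Ha] [Hb _]. destruct (rank_le_inv _ _ _ Hb m H1 H2) as (e & He & Hr).
  destruct (leq_or_lt olt olt_swo a e) as [H|H]; [|now destruct (Ha e H)].
  eapply leq_lt_trans; eauto using olt_swo.
Qed.

Lemma rank_order y n m a b : WO y -> field y n -> field y m ->
  rank_is y n a -> rank_is y m b -> (rel y n m <-> leq olt a b).
Proof.
  intros (_ & _ & _ & Htot & _) Hn Hm Ha Hb. destruct (Nat.eq_dec n m) as [<-|Hnm].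
  { split; auto. intros _. left. eapply rank_is_unique; eauto. }
  split; [intros H; right; eapply rank_lt; eauto|]. intros H.
  destruct (Htot n m Hn Hm) as [H1|H1]; auto. exfalso.
  refine (lt_not_leq olt olt_swo b a _ H). eapply rank_lt; eauto.
Qed.

(** The first [n] whose rank is not below [b] has rank exactly [b]; it exists since otherwise [b]
    would bound the order type. *)
Lemma rank_attained y g b : WO y -> otype_is y g -> olt b g ->
  exists n, field y n /\ rank_is y n b.
Proof.
  intros (Hfield & Hanti & _ & _ & Hleast) [_ Hg] Hb.
  destruct (Hleast (fun n => forall b', olt b' b -> ~ rank_le y n b')) as (n & H1 & Hn & H2).
  { apply NNPP. intros Hno. apply (Hg b Hb). intros n Hn. apply NNPP. intros Hn'.
    apply Hno. exists n. split; auto. intros b' H1 H2. eauto. }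
  exists n. split; auto. split; auto. constructor. intros m Hm Hne.
  apply NNPP. intros Hno. apply Hne. apply Hanti; auto. apply H2.
  - intros b' H3 H4. eauto.
  - apply (Hfield m n Hm).
Qed.

(** Elements of equal rank are matched. *)
Lemma otype_iso y y' g : WO y -> WO y' -> otype_is y g -> otype_is y' g -> iso_WO y y'.
Proof.
  intros W W' O O'.
  destruct (fun_choice _ _ (fun n m => field y n ->
    field y' m /\ exists b, rank_is y n b /\ rank_is y' m b)) as [f Hf].
  { intros n. destruct (classic (field y n)) as [Hn|Hn]; [|exists 0; tauto].
    destruct (rank_exists y g n (proj1 O) Hn) as (b & Hb & Hr).
    destruct (rank_attained y' g b W' O' Hb) as (m & Hm & Hr'). exists m. eauto. }
  assert (Hiff : forall n m, field y n -> field y m -> (rel y n m <-> rel y' (f n) (f m))).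
  { intros n m Hn Hm. destruct (Hf n Hn) as (F1 & a & A1 & A2), (Hf m Hm) as (F2 & b & B1 & B2).
    now rewrite (rank_order y n m a b), (rank_order y' (f n) (f m) a b). }
  exists f. split; [intros n Hn; now apply Hf|]. split; [|split; auto].
  - intros n m Hn Hm E. apply W; apply Hiff; auto; rewrite E; now apply Hf.
  - intros k Hk. destruct (rank_exists y' g k (proj1 O') Hk) as (b & Hb & Hr).
    destruct (rank_attained y g b W O Hb) as (n & Hn & Hrn). exists n. split; auto.
    destruct (Hf n Hn) as (F1 & a & A1 & A2).
    rewrite (rank_is_unique _ _ _ _ A1 Hrn) in A2.
    apply W'; [apply (rank_order y' _ _ b b)|apply (rank_order y' _ _ b b)]; auto; now left.
Qed.

Lemma E0_not_to_iso_WO (h : Real -> Real) :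
  (forall n, BP (fun x => h x n = true)) -> (forall x, WO (h x)) ->
  ~ (forall x y, E0 x y <-> iso_WO (h x) (h y)).
Proof.
  intros Hb HW Hred. pose proof olt_swo as S.
  assert (HR : forall a n, BP (fun x => rank_le (h x) n a)).
  { induction a as [a IH] using (well_founded_ind (proj2 (proj2 (proj2 S)))). intros n.
    apply BP_iff with (A := fun x => forall m, rel (h x) m n -> m <> n ->
      exists b, olt b a /\ rank_le (h x) m b).
    - intros x. split; [now constructor|apply rank_le_inv].
    - apply BP_all; [apply countable_nat|]. intros m. apply BP_imp; [apply Hb|].
      apply BP_imp; [apply BP_const|]. apply BP_ex_below. intros b Hba. now apply IH. }
  assert (HO : forall g, BP (fun x => otype_le (h x) g)).
  { intros g. apply BP_all; [apply countable_nat|]. intros n. apply BP_imp; [apply Hb|].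
    apply BP_ex_below. intros b _. apply HR. }
  assert (HL : forall g, BP (fun x => otype_is (h x) g)).
  { intros g. apply BP_and; auto. apply BP_all_below. intros g' _. now apply BP_not. }
  (* Boundedness: no condition can force a new rank to appear at or beyond [d]. *)
  destruct (omega1_bound (nat * list bool)
    (fun p b => forces (snd p) (fun x => rank_le (h x) (fst p) b))) as [d Hd].
  { apply countable_prod; [apply countable_nat|apply countable_list_bool]. }
  destruct (omega1_succ d) as [e He].
  assert (Hbound : forces [] (fun x => otype_le (h x) e)).
  (* Where a rank is forced to be at most [e], it is forced to be below [d]; so comeagerly no rank
     lies above [d] and at most at [e]. *)
  { apply forces_mono with (A := fun x => forall n, ~ (rank_le (h x) n e /\ ~ rank_le (h x) n d)).
    - apply forces_all; [apply countable_nat|]. intros n. apply BP_no_extension.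
      + apply BP_and; auto. now apply BP_not.
      + intros t _ Ht. destruct (Hd (n, t)) as (b & Hbd & Hf).
        { exists e. eapply forces_mono; [exact Ht|]. now intros x _ []. }
        apply (forces_not_both t (fun x => rank_le (h x) n d)).
        * eapply forces_mono; [exact Hf|]. intros x _ Hx.
          apply (rank_le_mono _ _ b); [exact Hx|now right].
        * eapply forces_mono; [exact Ht|]. now intros x _ [].
    (* The first element of rank above [d] would have rank at most [e], its predecessors having rank
       at most [d]. *)
    - intros x _ Hx. intros n Hn. exists d. split; auto. apply NNPP. intros Hno.
      destruct (HW x) as (Hfield & Hanti & _ & _ & Hleast).
      destruct (Hleast (fun n => ~ rank_le (h x) n d)) as (m & H1 & Hm & H2); [eauto|].
      apply (Hx m). split; auto. constructor. intros k Hk Hne. exists d. split; auto.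
      apply NNPP. intros Hk'. apply Hne, Hanti; auto. apply H2; auto. apply (Hfield k m Hk). }
  (* Only countably many order types are at most [e], so one of them is taken on a nonmeager set. *)
  assert (Hforce : exists s g, forces s (fun x => otype_is (h x) g)).
  { apply NNPP. intros Hno. destruct (omega1_succ e) as [e' He'].
    destruct (omega1_segment e') as [en Hen].
    assert (Hall : forces [] (fun x => forall n, ~ otype_is (h x) (en n))).
    { apply forces_all; [apply countable_nat|]. intros n. apply BP_no_extension; auto.
      intros t _ Ht. eauto. }
    destruct (forces_inhabited _ _ (forces_and _ _ _ Hbound Hall)) as (x & _ & H1 & H2).
    destruct (least_element olt (otype_le (h x))) as (g & G1 & G2); [apply S|eauto|].
    assert (Hge : olt g e').
    { destruct (leq_or_lt olt S g e) as [H|H]; [eapply leq_lt_trans; eauto|].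
      now destruct (G2 e H). }
    destruct (Hen g Hge) as [n Hn]. apply (H2 n). rewrite Hn. now split. }
  destruct Hforce as (s & g & Hs).
  destruct (forces_inhabited _ _ Hs) as (x & _ & Hx).
  destruct (forces_inhabited _ _ (forces_and _ _ _ Hs (forces_not_E0 s x))) as (y & _ & Hy & Hn).
  apply Hn, Hred. eapply otype_iso; eauto.
Qed.

(** * Codes *)

(** A number stands for the finite set of positions of its 1 digits, so the members of an [E0]-class
    are indexed by [nat]. *)
Lemma mask_exists (g : nat -> bool) N :
  (forall k, N <= k -> g k = false) -> exists t, forall k, Nat.testbit t k = g k.
Proof.
  revert g. induction N as [|N IH]; intros g Hg.
  - exists 0. intros k. rewrite Nat.bits_0. symmetry. apply Hg. lia.
  - destruct (IH (fun k => g (S k))) as [t Ht]; [intros k Hk; apply Hg; lia|].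
    exists (2 * t + Nat.b2n (g 0)). intros [|k].
    + apply Nat.testbit_0_r.
    + rewrite <- Ht. apply Nat.testbit_succ_r.
Qed.

Lemma testbit_eventually_false t : exists N, forall k, N <= k -> Nat.testbit t k = false.
Proof. exists (S (Nat.log2 t)). intros k Hk. apply Nat.bits_above_log2. lia. Qed.

Lemma E0_mask x y : E0 x y -> exists t, forall k, Nat.testbit t k = xorb (x k) (y k).
Proof.
  intros [N HN]. apply (mask_exists _ N). intros k Hk. rewrite (HN k Hk). apply xorb_nilpotent.
Qed.

Lemma mask_E0 x y t : (forall k, x k = xorb (y k) (Nat.testbit t k)) -> E0 x y.
Proof.
  intros H. destruct (testbit_eventually_false t) as [N HN]. exists N. intros k Hk.
  rewrite H, HN by auto. now destruct (y k).
Qed.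

Lemma pair_surj n : exists i m, n = pair i m.
Proof.
  exists (fst (of_nat n)), (snd (of_nat n)). rewrite pair_to_nat.
  now rewrite <- surjective_pairing, cancel_to_of.
Qed.

(* The [pair i m]-th element interleaves [seq_elem x i], altered by the finite mask [m],
   with the characteristic function of [i]. *)
Definition set_code (x : Real) : Real := fun j =>
  let (n, k) := of_nat j in let (i, m) := of_nat n in
  if Nat.even k then xorb (x (pair i (Nat.div2 k))) (Nat.testbit m (Nat.div2 k))
  else Nat.div2 k =? i.

Lemma set_code_even x i m k :
  seq_elem (set_code x) (pair i m) (2 * k) = xorb (seq_elem x i k) (Nat.testbit m k).
Proof.
  unfold seq_elem, set_code. rewrite pair_to_nat, cancel_of_to, pair_to_nat, cancel_of_to.
  now rewrite Nat.even_even, Nat.div2_double.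
Qed.

Lemma set_code_odd x i m k :
  seq_elem (set_code x) (pair i m) (2 * k + 1) = (k =? i).
Proof.
  unfold seq_elem, set_code. rewrite pair_to_nat, cancel_of_to, pair_to_nat, cancel_of_to.
  rewrite Nat.even_odd, Nat.add_1_r, Nat.div2_succ_double. reflexivity.
Qed.

Lemma set_code_BP (phi : Real -> Real) : (forall n, BP (fun z => phi z n = true)) ->
  forall n, BP (fun z => set_code (phi z) n = true).
Proof.
  intros H n. unfold set_code. destruct (of_nat n) as [a k], (of_nat a) as [i m].
  destruct (Nat.even k); [|apply BP_const].
  destruct (Nat.testbit m _).
  - apply BP_iff with (A := fun z => ~ phi z (pair i (Nat.div2 k)) = true); [|apply BP_not, H].
    intros z. destruct (phi z _); simpl; intuition congruence.
  - apply BP_iff with (A := fun z => phi z (pair i (Nat.div2 k)) = true); [|apply H].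
    intros z. now rewrite xorb_false_r.
Qed.

Lemma E0_sym x y : E0 x y -> E0 y x.
Proof. intros [N HN]. exists N. intros n Hn. symmetry. auto. Qed.

Lemma set_code_member x y : E3 x y ->
  forall n, exists m, real_eq (seq_elem (set_code x) n) (seq_elem (set_code y) m).
Proof.
  intros H n. destruct (pair_surj n) as (i & m & ->).
  (* [t] records where rows [i] of [x] and [y] differ; combining it with the mask makes up for the
     difference. *)
  destruct (E0_mask _ _ (H i)) as [t Ht]. exists (pair i (Nat.lxor m t)). intros k.
  destruct (Nat.Even_or_Odd k) as [[j ->]|[j ->]].
  - rewrite !set_code_even, Nat.lxor_spec, Ht.
    now destruct (seq_elem x i j), (seq_elem y i j), (Nat.testbit m j).
  - now rewrite !set_code_odd.
Qed.

Lemma set_code_spec x y : E3 x y <-> Eset (set_code x) (set_code y).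
Proof.
  split.
  - intros H. split; apply set_code_member; auto. intros i. apply E0_sym, H.
  - intros [H _] i. destruct (H (pair i 0)) as [m Hm].
    destruct (pair_surj m) as (i' & t & ->).
    (* The odd positions carry the index of the row, so members from different rows never
       coincide. *)
    assert (E : i = i').
    { specialize (Hm (2 * i + 1)). rewrite !set_code_odd, Nat.eqb_refl in Hm.
      now apply Nat.eqb_eq. }
    subst i'. apply (mask_E0 _ _ t). intros k. specialize (Hm (2 * k)).
    rewrite !set_code_even, Nat.bits_0, xorb_false_r in Hm. exact Hm.
Qed.

Definition const_rows (z : Real) : Real := fun j => z (snd (of_nat j)).

Lemma const_rows_spec x y : E0 x y <-> E3 (const_rows x) (const_rows y).
Proof.
  assert (H : forall z i, seq_elem (const_rows z) i = z).
  { intros z i. apply functional_extensionality. intros k.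
    unfold seq_elem, const_rows. now rewrite pair_to_nat, cancel_of_to. }
  unfold E3. split; [intros HE i|intros HE; specialize (HE 0)]; now rewrite !H in *.
Qed.

(* Node [2 i] is the von Neumann numeral [i]; node [2 m + 1] is the set of all odd numerals
   together with the [2 k] for [k] in [z], altered by the finite mask [m]. The odd numerals
   keep this set infinite, hence distinct from every numeral. *)
Definition hc_code (z : Real) : Real := fun j =>
  let (a, b) := of_nat j in
  if Nat.even a then
    let i := Nat.div2 a in
    if Nat.even b then i <? Nat.div2 b
    else Nat.odd i || xorb (z (Nat.div2 i)) (Nat.testbit (Nat.div2 b) (Nat.div2 i))
  else false.

Lemma hc_code_odd z i b : ~ rel (hc_code z) (2 * i + 1) b.
Proof.
  unfold rel, hc_code. rewrite pair_to_nat, cancel_of_to, Nat.even_odd. congruence.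
Qed.

Lemma hc_code_numeral z i j : rel (hc_code z) (2 * i) (2 * j) <-> i < j.
Proof.
  unfold rel, hc_code. rewrite pair_to_nat, cancel_of_to, !Nat.even_even, !Nat.div2_double.
  apply Nat.ltb_lt.
Qed.

Lemma hc_code_set z i m : rel (hc_code z) (2 * i) (2 * m + 1) <->
  Nat.odd i || xorb (z (Nat.div2 i)) (Nat.testbit m (Nat.div2 i)) = true.
Proof.
  unfold rel, hc_code. rewrite pair_to_nat, cancel_of_to, Nat.even_even, Nat.even_odd.
  now rewrite Nat.div2_double, Nat.add_1_r, Nat.div2_succ_double.
Qed.

Lemma hc_code_set_odd z i m : rel (hc_code z) (2 * (2 * i + 1)) (2 * m + 1).
Proof. apply hc_code_set. now rewrite Nat.odd_odd. Qed.

Lemma hc_code_set_even z i m :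
  rel (hc_code z) (2 * (2 * i)) (2 * m + 1) <-> xorb (z i) (Nat.testbit m i) = true.
Proof. rewrite hc_code_set. now rewrite Nat.odd_even, Nat.div2_double. Qed.

Lemma hc_code_BP n : BP (fun z => hc_code z n = true).
Proof.
  unfold hc_code. destruct (of_nat n) as [a b]. destruct (Nat.even a); [|apply BP_const].
  destruct (Nat.even b); [apply BP_const|]. set (i := Nat.div2 a).
  destruct (Nat.odd i); simpl; [apply BP_const|].
  destruct (Nat.testbit _ _).
  - apply BP_iff with (A := fun x => ~ x (Nat.div2 i) = true); [|apply BP_not, BP_bit].
    intros x. destruct (x _); simpl; intuition congruence.
  - apply BP_iff with (A := fun x => x (Nat.div2 i) = true); [|apply BP_bit].
    intros x. now rewrite xorb_false_r.
Qed.

Lemma hc_code_HC z : HC (hc_code z).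
Proof.
  split.
  - assert (He : forall i, Acc (rel (hc_code z)) (2 * i)).
    { intros i. induction (lt_wf i) as [i _ IH]. constructor. intros y Hy.
      destruct (Nat.Even_or_Odd y) as [[j ->]|[j ->]].
      - apply IH. now apply hc_code_numeral in Hy.
      - now apply hc_code_odd in Hy. }
    intros a. destruct (Nat.Even_or_Odd a) as [[i ->]|[i ->]]; auto.
    constructor. intros y Hy. destruct (Nat.Even_or_Odd y) as [[j ->]|[j ->]]; auto.
    now apply hc_code_odd in Hy.
  (* The numeral [2 * i + 1] belongs to every set node but not to the numeral [i]. *)
  - assert (Hne : forall i m, ~ forall c, rel (hc_code z) c (2 * i) <-> rel (hc_code z) c (2 * m + 1)).
    { intros i m H. pose proof (hc_code_set_odd z i m) as Hs.
      apply H in Hs. apply hc_code_numeral in Hs. lia. }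
    intros a b H.
    destruct (Nat.Even_or_Odd a) as [[i ->]|[i ->]], (Nat.Even_or_Odd b) as [[j ->]|[j ->]].
    + destruct (Nat.lt_trichotomy i j) as [Hlt|[->|Hlt]]; auto; exfalso.
      * apply (hc_code_numeral z) in Hlt. apply H in Hlt. apply hc_code_numeral in Hlt. lia.
      * apply (hc_code_numeral z) in Hlt. apply H in Hlt. apply hc_code_numeral in Hlt. lia.
    + now destruct (Hne i j).
    + destruct (Hne j i). intros c. symmetry. apply H.
    (* The even numerals in the two sets determine the masks. *)
    + do 2 f_equal. apply Nat.bits_inj. intros k. specialize (H (2 * (2 * k))).
      rewrite !hc_code_set_even in H. apply bool_eq_iff in H.
      now destruct (z k), (Nat.testbit i k), (Nat.testbit j k).
Qed.

Lemma hc_code_spec x y : E0 x y <-> iso_HC (hc_code x) (hc_code y).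
Proof.
  split.
  - intros HE. destruct (E0_mask _ _ HE) as [t Ht].
    (* Numerals stay fixed and masks are shifted by the difference of [x] and [y]; the map is an
       involution. *)
    set (f := fun n => if Nat.even n then n else 2 * Nat.lxor (Nat.div2 n) t + 1).
    assert (Fe : forall i, f (2 * i) = 2 * i) by (intros i; unfold f; now rewrite Nat.even_even).
    assert (Fo : forall m, f (2 * m + 1) = 2 * Nat.lxor m t + 1).
    { intros m. unfold f. now rewrite Nat.even_odd, (Nat.add_1_r (2 * m)), Nat.div2_succ_double. }
    assert (Ff : forall n, f (f n) = n).
    { intros n. destruct (Nat.Even_or_Odd n) as [[i ->]|[i ->]].
      - now rewrite !Fe.
      - now rewrite !Fo, Nat.lxor_assoc, Nat.lxor_nilpotent, Nat.lxor_0_r. }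
    exists f. split; [|split].
    + intros n m H. rewrite <- (Ff n), <- (Ff m). now rewrite H.
    + intros k. exists (f k). apply Ff.
    + intros n m. destruct (Nat.Even_or_Odd n) as [[i ->]|[i ->]].
      * rewrite Fe. destruct (Nat.Even_or_Odd m) as [[j ->]|[j ->]].
        -- rewrite Fe. now rewrite !hc_code_numeral.
        -- rewrite Fo, !hc_code_set, Nat.lxor_spec, Ht.
           now destruct (Nat.odd i), (x (Nat.div2 i)), (y (Nat.div2 i)), (Nat.testbit j (Nat.div2 i)).
      * rewrite Fo. split; intros H; now apply hc_code_odd in H.
  - intros (f & Finj & Fsurj & Frel).
    (* An isomorphism fixes every numeral: by induction it fixes the members, and extensionality
       does the rest. *)
    assert (Fe : forall i, f (2 * i) = 2 * i).
    { intros i. induction (lt_wf i) as [i _ IH]. apply (proj2 (hc_code_HC y)). intros c. split.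
      - intros H. destruct (Fsurj c) as [c' <-]. apply Frel in H.
        destruct (Nat.Even_or_Odd c') as [[j ->]|[j ->]]; [|now apply hc_code_odd in H].
        apply hc_code_numeral in H. rewrite IH by auto. now apply hc_code_numeral.
      - intros H. destruct (Nat.Even_or_Odd c) as [[j ->]|[j ->]]; [|now apply hc_code_odd in H].
        apply hc_code_numeral in H. rewrite <- IH by auto. apply Frel. now apply hc_code_numeral. }
    (* Node 1 represents [x] with the empty mask. It cannot go to a numeral, each being its own
       image, so it goes to a set node with some mask [t], by which [x] and [y] differ. *)
    destruct (Nat.Even_or_Odd (f (2 * 0 + 1))) as [[i Hi]|[t Ht]].
    + rewrite <- (Fe i) in Hi. apply Finj in Hi. lia.
    + apply (mask_E0 _ _ t). intros k. apply bool_eq_iff.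
      rewrite <- hc_code_set_even, <- Ht, <- (Fe (2 * k)), <- Frel, hc_code_set_even.
      now rewrite Nat.bits_0, xorb_false_r.
Qed.

(** * From computable reductions to Baire-measurable ones *)

Theorem mainTheorem8 :
  (~ itt_reducible allR E0 allR real_eq) /\
  (~ itt_reducible allR Eset allR E0) /\
  (~ itt_reducible HC iso_HC WO iso_WO) /\
  (~ itt_reducible allR Eset WO iso_WO).
Proof.
  split; [|split; [|split]]; intros (f & Hcomp & HY & Hred).
  - apply (E0_not_to_eq f).
    + apply (itt_output_BP allR f (fun z => z) Hcomp); [easy|apply BP_bit].
    + intros x y. now apply Hred.
  - apply (E3_not_to_E0 (fun z => f (set_code z))).
    + apply (itt_output_BP allR f set_code Hcomp); [easy|].
      apply (set_code_BP (fun z => z)), BP_bit.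
    + intros x y. rewrite set_code_spec. now apply Hred.
  - apply (E0_not_to_iso_WO (fun z => f (hc_code z))).
    + apply (itt_output_BP HC f hc_code Hcomp); [apply hc_code_HC|apply hc_code_BP].
    + intros x. apply HY, hc_code_HC.
    + intros x y. rewrite hc_code_spec. apply Hred; apply hc_code_HC.
  (* [E0] reaches [Eset] through its countable power. *)
  - apply (E0_not_to_iso_WO (fun z => f (set_code (const_rows z)))).
    + apply (itt_output_BP allR f (fun z => set_code (const_rows z)) Hcomp); [easy|].
      apply set_code_BP. intros n. apply BP_bit.
    + intros x. now apply HY.
    + intros x y. rewrite const_rows_spec, set_code_spec. now apply Hred.
Qed.
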